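(* Let $\Omega\subset\mathbb{R}^d$ be an open set, let $T_1=\vec T_1\|T_1\|,\dots,T_d=\vec T_d\|T_d\|\in\mathbf{N}_1(\Omega)$ be one-dimensional normal currents, and assume there exists a positive Radon measure $\sigma\in\mathcal{M}(\Omega)$ satisfying the following properties: (i) $\sigma\ll\|T_i\|$ for all $i=1,\dots,d$; (ii) $\mathrm{span}\{\vec T_1(x),\dots,\vec T_d(x)\}=\mathbb{R}^d$ for $\sigma$-almost every $x\in\Omega$. Then $\sigma\ll\mathcal{H}^\kappa$ for all $0\le\kappa<d$.
   Context: $\mathcal{M}(\Omega;E)$ is the space of $E$-valued (locally finite) Radon measures on $\Omega$, $\mathcal{M}(\Omega)=\mathcal{M}(\Omega;\mathbb{R})$. A one-dimensional normal current $T\in\mathbf{N}_1(\Omega)$ is a $1$-current (a distribution with values in $\bigwedge_1\mathbb{R}^d=\mathbb{R}^d$) such that both $T$ and its boundary $\partial T$, defined by $\partial T[\omega]=T(\mathrm{d}\omega)$ for $\omega\in C_c^\infty(\Omega)$, are represented by measures: $T\in\mathcal{M}(\Omega;\mathbb{R}^d)$ and $\partial T\in\mathcal{M}(\Omega;\mathbb{R})$. $\|T\|$ is the total variation of $T$ and $T=\vec T\,\|T\|$ is its polar decomposition. $\mathcal{H}^\kappa$ is the $\kappa$-dimensional Hausdorff measure on $\mathbb{R}^d$. *)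

(* Defs.v *)
From HB Require Import structures.
From mathcomp Require Import all_boot all_order all_algebra.
From mathcomp Require Import all_classical all_reals all_analysis.

Set Implicit Arguments.
Unset Strict Implicit.
Unset Printing Implicit Defensive.

Import Order.TTheory GRing.Theory Num.Theory.
Import numFieldNormedType.Exports.

Local Open Scope classical_set_scope.
Local Open Scope ring_scope.

(* R^d is 'rV[R]_d; [borel R d] is the same type with its Borel sigma-algebra. *)
Notation borel R d := (g_sigma_algebraType (@open 'rV[R]_d)).

Section EuclideanSpace.
Variables (R : realType) (d : nat).

(* The library norm on 'rV[R]_d is the sup norm. *)
Definition enorm (v : 'rV[R]_d) : R := Num.sqrt (\sum_(j < d) v ord0 j ^+ 2).

Definition edot (u v : 'rV[R]_d) : R := \sum_(j < d) u ord0 j * v ord0 j.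

Definition ediam (A : set 'rV[R]_d) : \bar R :=
  ereal_sup [set (enorm (p.1 - p.2))%:E | p in A `*` A].

End EuclideanSpace.

Section Hausdorff.
Local Open Scope ereal_scope.
Variables (R : realType) (d : nat).

(* (diam U)^kappa, with value 0 on the empty set and (diam U)^0 = 1 otherwise. *)
Definition diam_pow (kappa : R) (U : set 'rV[R]_d) : \bar R :=
  if U == set0 then 0 else ediam U `^ kappa.

Definition hausdorff_delta (kappa delta : R) (A : set 'rV[R]_d) : \bar R :=
  ereal_inf [set \sum_(k <oo) diam_pow kappa (U k) |
    U in [set U : (set 'rV[R]_d)^nat |
            A `<=` \bigcup_k U k /\ forall k, ediam (U k) <= delta%:E]].

(* Normalized without the dimensional constant; this only rescales the measure
   by a positive factor. *)
Definition hausdorff (kappa : R) (A : set (borel R d)) : \bar R :=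
  ereal_sup [set hausdorff_delta kappa delta A |
    delta in [set delta : R | (0 < delta)%R]].

End Hausdorff.

Section RadonMeasures.
Variables (R : realType) (d : nat) (Omega : set 'rV[R]_d).

(* Bounded Borel sets of Omega, on which Radon vector measures are defined. *)
Definition inside_compact (A : set 'rV[R]_d) :=
  exists K : set 'rV[R]_d, [/\ compact K, K `<=` Omega & A `<=` K].

(* A positive measure on Omega is a Borel measure on R^d carried by Omega. *)
Definition positive_radon (mu : {measure set (borel R d) -> \bar R}) :=
  mu (~` Omega) = 0%E /\
  forall K : set 'rV[R]_d, compact K -> K `<=` Omega -> (mu K < +oo)%E.

(* R^n-valued locally finite Radon measures on Omega.  Such a measure need not
   have a value on Borel sets that are not contained in a compact subset of
   Omega; there [rm_fun] is arbitrary and never used. *)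
Record radon_measure (n : nat) := RadonMeasure {
  rm_fun :> set (borel R d) -> 'rV[R]_n ;
  rm_sigma_additive : forall (K : set 'rV[R]_d) (F : (set (borel R d))^nat),
    compact K -> K `<=` Omega ->
    (forall k, measurable (F k)) -> (forall k, F k `<=` K) ->
    trivIset setT F ->
    series (fun k => rm_fun (F k)) @ \oo --> rm_fun (\bigcup_k F k) }.

Definition total_variation n (T : radon_measure n) (A : set (borel R d)) :
    \bar R :=
  ereal_sup [set (\sum_(k <oo) (enorm (T (F k)))%:E)%E |
    F in [set F : (set (borel R d))^nat |
      [/\ forall k, measurable (F k),
          forall k, inside_compact (F k),
          trivIset setT F
        & forall k, F k `<=` A]]].

(* Polar decomposition T = vec ||T||.  It exists for every Radon measure T (by
   Radon-Nikodym), with [polar_dir] unique up to ||T||-negligible sets. *)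
Record polar_decomposition n (T : radon_measure n) := PolarDecomposition {
  polar_tv : {measure set (borel R d) -> \bar R} ;
  polar_dir : borel R d -> 'rV[R]_n ;
  polar_tvE : forall A : set (borel R d),
    measurable A -> polar_tv A = total_variation T A ;
  polar_tv_radon : positive_radon polar_tv ;
  polar_dir_measurable : forall j : 'I_n,
    measurable_fun setT (fun x => polar_dir x ord0 j) ;
  polar_dir_unit : {ae polar_tv, forall x, enorm (polar_dir x) = 1} ;
  polarE : forall A : set (borel R d),
    measurable A -> inside_compact A -> forall j : 'I_n,
    T A ord0 j = \int[polar_tv]_(x in A) polar_dir x ord0 j }.

(* T[omega] = \int omega . dT = \int <omega, vec T> d||T|| *)
Definition pairing n (T : radon_measure n) (P : polar_decomposition T)
    (omega : 'rV[R]_d -> 'rV[R]_n) : R :=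
  \int[polar_tv P]_x edot (omega x) (polar_dir P x).

End RadonMeasures.

Section Currents.
Variables (R : realType) (d : nat).

Definition partial (j : 'I_d) (f : 'rV[R]_d -> R) : 'rV[R]_d -> R :=
  fun x => 'D_(delta_mx ord0 j) f x.

Definition iter_partial (s : seq 'I_d) (f : 'rV[R]_d -> R) : 'rV[R]_d -> R :=
  foldr partial f s.

Definition smooth (f : 'rV[R]_d -> R) :=
  forall s : seq 'I_d, continuous (iter_partial s f) /\
    forall (j : 'I_d) (x : 'rV[R]_d),
      derivable (iter_partial s f) x (delta_mx ord0 j).

Definition test_function (Omega : set 'rV[R]_d) (phi : 'rV[R]_d -> R) :=
  [/\ smooth phi,
      compact (closure [set x | phi x != 0])
    & closure [set x | phi x != 0] `<=` Omega].

Definition ext_deriv (phi : 'rV[R]_d -> R) : 'rV[R]_d -> 'rV[R]_d :=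
  fun x => \row_j partial j phi x.

Variable Omega : set 'rV[R]_d.

Definition boundary (T : radon_measure Omega d) (P : polar_decomposition T)
    (phi : 'rV[R]_d -> R) : R := pairing P (ext_deriv phi).

(* A 1-current represented by a Radon measure T is normal when its boundary is
   represented by some nu in M(Omega; R), where R is identified with 'rV_1. *)
Definition normal_current (T : radon_measure Omega d)
    (P : polar_decomposition T) :=
  exists (nu : radon_measure Omega 1) (Q : polar_decomposition nu),
    forall phi : 'rV[R]_d -> R, test_function Omega phi ->
      boundary P phi = pairing Q (fun x => const_mx (phi x)).

End Currents.

(* Main.v *)
Require Import Defs.
From HB Require Import structures.
From mathcomp Require Import all_boot all_order all_algebra.
From mathcomp Require Import all_classical all_reals all_analysis.
From mathcomp Require Import measurable_realfun.
From mathcomp Require Import ring lra.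

(**
The idea is that at small scales the currents force a common measure to be almost
translation invariant, and that a measure which is almost translation invariant
at all small scales around a point must have dimension d there.

Work on a compact K contained in Omega.  Let mu be a finite measure that dominates
the restrictions to K of all the ||T_i|| and of all the total variations of the
boundaries, and write T_i = g_i mu.  For a test function phi supported in a ball
B_r(x) the definition of the boundary gives
   | int <g_i, grad phi> dmu |  <=  sup |phi| mu(B_r(x)).
If x is a Lebesgue point of the g_i one may replace g_i by g_i(x) up to a small
error, and if the vectors g_i(x) span R^d one may then solve for each partial
derivative: r | int d_j phi dmu | is at most mu(B_10r(x)) for the rescaled bumps
phi of size r, as soon as r is small ([small_derivative]).  For sigma-almost every x
the g_i(x) do span, because the directions span and sigma << ||T_i||.

Now let b be a bump on the line with primitive B.  The difference of products
   lam^d prod_j b(lam s_j) - prod_j b(s_j)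
telescopes into d terms, each of which is a partial derivative of a product
function, with factor B(lam s_j) - B(s_j) in the j-th slot ([dilation_identity]).
Integrating against mu at scale r gives
   lam^d mu(B_{delta r / lam}(x))  <=  K mu(B_10r(x))     for small r,
with K and delta independent of lam ([decay_step]).  For kappa < d a large lam
absorbs K and all the other constants, and iteration gives
mu(B_r(x)) <= C r^kappa ([power_decay]).  Covering a set of zero H^kappa measure
by small sets shows that its points with this decay form a mu-null set
([decay_negligible]), hence a sigma-null set, since sigma << ||T_i|| <= mu on K.

Balls are those of the sup norm, that is, cubes; they fit product functions.  The
measure mu is not assumed to be doubling, and averages are therefore normalized by
the measure of an enlarged ball: the integral of |f - f(x)| over B_r(x) is compared
with mu(B_10r(x)).  In this form Lebesgue's theorem follows from the elementary
Vitali argument for every finite measure ([vitali_measure],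
[enlarged_lebesgue_point]), and the enlargement costs nothing, as lam is
arbitrary.
*)

Set Implicit Arguments.
Unset Strict Implicit.
Unset Printing Implicit Defensive.

Import Order.TTheory GRing.Theory Num.Theory.
Import numFieldNormedType.Exports.

Local Open Scope classical_set_scope.
Local Open Scope ring_scope.

(** * Smooth functions of one real variable *)

Section SmoothReal.
Variable R : realType.
Implicit Types (u v w : R -> R) (n : nat).

(** The derivative is carried along as an existential witness rather than
computed by iterating the derivative operator: closure under sums, products and
inverses then follows by induction on the order. *)
Fixpoint times_derivable n u : Prop :=
  if n is m.+1 then
    exists2 u', forall t : R, is_derive t 1 u (u' t) & times_derivable m u'
  else True.

Definition smooth1 u := forall n, times_derivable n u.

Lemma times_derivableW n u : times_derivable n.+1 u -> times_derivable n u.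
Proof.
elim: n u => [//|n IHn] u [u' du' nu'].
by exists u' => //; exact: IHn.
Qed.

Lemma times_derivable_cst n (c : R) : times_derivable n (fun=> c).
Proof.
elim: n c => [//|n IHn] c /=; exists (fun=> 0) => // t.
exact: is_derive_cst.
Qed.

Lemma times_derivableD n u v :
  times_derivable n u -> times_derivable n v -> times_derivable n (u \+ v).
Proof.
elim: n u v => [//|n IHn] u v [u' du nu] [v' dv nv] /=.
by exists (u' \+ v'); [move=> t; exact: is_deriveD|exact: IHn].
Qed.

Lemma times_derivableM n u v :
  times_derivable n u -> times_derivable n v -> times_derivable n (u \* v).
Proof.
elim: n u v => [//|n IHn] u v nu nv.
have [nu0 nv0] := (times_derivableW nu, times_derivableW nv).
move: nu nv => [u' du nu] [v' dv nv] /=.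
exists ((u \* v') \+ (v \* u')); last by apply: times_derivableD; exact: IHn.
move=> t; exact: is_deriveM.
Qed.

Lemma is_derive_aff (a c t : R) : is_derive t 1 (fun s => a * s + c) a.
Proof. by apply: is_derive_eq; rewrite /GRing.scale/= addr0 mulr1. Qed.

Lemma times_derivable_aff n u (a c : R) :
  times_derivable n u -> times_derivable n (fun t => u (a * t + c)).
Proof.
elim: n u => [//|n IHn] u [u' du nu] /=.
exists ((fun=> a) \* (fun t => u' (a * t + c))); last first.
  by apply: times_derivableM; [exact: times_derivable_cst|exact: IHn].
move=> t; rewrite /= mulrC.
exact: (is_derive1_comp (du _) (is_derive_aff a c t)).
Qed.

(** The derivative - u' / u^2 is again a product of u' with inverses of u, so
the induction hypothesis applies to it. *)
Lemma times_derivableV n u : (forall t, u t != 0) ->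
  times_derivable n u -> times_derivable n (fun t => (u t)^-1).
Proof.
move=> u0; elim: n => [//|n IHn] nu.
have nu0 := times_derivableW nu.
move: nu => [u' du nu] /=.
exists ((fun=> -1) \* (u' \* ((fun t => (u t)^-1) \* (fun t => (u t)^-1)))).
  move=> t; apply: is_derive_eq; rewrite /GRing.scale/= -exprVn; ring.
apply: times_derivableM; first exact: times_derivable_cst.
by apply: times_derivableM => //; apply: times_derivableM; exact: IHn.
Qed.

Lemma smooth1_derive u : smooth1 u ->
  (forall t : R, is_derive t 1 u ('D_1 u t)) /\ smooth1 (fun t => 'D_1 u t).
Proof.
move=> su; split=> [t|n].
  by have [u' du _] := su 1%N; apply: DeriveDef => //; exact: ex_derive.
have [u' du nu] := su n.+1.
by rewrite (_ : (fun t => _) = u')//; apply/funext => t; rewrite derive_val.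
Qed.

Lemma smooth1_continuous u : smooth1 u -> continuous u.
Proof.
move=> su t; have [u' du _] := su 1%N.
by apply: differentiable_continuous; apply/derivable1_diffP; exact: ex_derive.
Qed.

End SmoothReal.

(** * Flat functions *)

Section FlatFunctions.
Variable R : realType.

(** The functions t^(-n) exp(-1/t) on t > 0, extended by 0, span a space that is
stable under derivation; this is why the whole family is studied instead of
exp(-1/t) alone. *)
Definition flat n (t : R) : R :=
  if 0 < t then t^-1 ^+ n * expR (- t^-1) else 0.

Lemma flat_ge0 n t : 0 <= flat n t.
Proof.
rewrite /flat; case: ifP => // t0.
by rewrite mulr_ge0 ?expR_ge0// exprn_ge0// invr_ge0 ltW.
Qed.

Lemma flat_gt0 n t : 0 < t -> 0 < flat n t.
Proof.
by move=> t0; rewrite /flat t0 mulr_gt0 ?expR_gt0// exprn_gt0// invr_gt0.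
Qed.

Lemma flat_le0 n t : t <= 0 -> flat n t = 0.
Proof. by rewrite /flat leNgt => /negbTE ->. Qed.

(** exp s = (exp (s/n))^n and exp (s/n) >= s/n. *)
Lemma exprn_expRN_le n (s : R) : 0 <= s -> s ^+ n * expR (- s) <= n%:R ^+ n.
Proof.
move=> s0; case: n => [|n]; first by rewrite !expr0 mul1r expR_le1 oppr_le0.
have n0 : 0 < n.+1%:R :> R by rewrite ltr0n.
rewrite expRN ler_pdivrMr ?expR_gt0//.
have -> : expR s = expR (s / n.+1%:R) ^+ n.+1.
  by rewrite -expRM_natl mulrC divfK// gt_eqF.
rewrite -exprMn lerXn2r ?nnegrE//.
rewrite -ler_pdivrMl// mulrC.
by apply: le_trans (expR_ge1Dx _); rewrite lerDr.
Qed.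

(** A quadratic bound is all that is needed for the derivative at 0 to vanish. *)
Lemma flat_sqr_le n t : `|flat n t| <= n.+2%:R ^+ n.+2 * t ^+ 2.
Proof.
rewrite ger0_norm ?flat_ge0//; have [t0|t0] := ltP 0 t; last first.
  by rewrite flat_le0// mulr_ge0 ?sqr_ge0// exprn_ge0.
rewrite /flat t0 -ler_pdivrMr ?exprn_gt0//.
rewrite -exprVn mulrAC -exprD addn2.
by apply: exprn_expRN_le; rewrite invr_ge0 ltW.
Qed.

Lemma is_derive_flat0 n : is_derive (0 : R) 1 (flat n) 0.
Proof.
suff h : h^-1 *: (flat n (h *: 1 + 0) - flat n 0) @[h --> 0^'] --> (0 : R).
  by apply: DeriveDef; [apply/cvg_ex; exists 0|apply: cvg_lim h].
pose C : R := n.+2%:R ^+ n.+2.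
have C0 : 0 < C by rewrite exprn_gt0.
apply/cvgrPdist_le => e e0; near=> h.
rewrite sub0r normrN [flat n 0]flat_le0// subr0 addr0 /GRing.scale/= mulr1.
have h0 : h != 0 by near: h; exact: nbhs_dnbhs_neq.
rewrite normrM normfV ler_pdivrMl ?normr_gt0//.
apply: (le_trans (flat_sqr_le n h)); rewrite -/C.
rewrite -[h ^+ 2](real_normK (num_real h)) expr2 mulrCA ler_wpM2l//.
rewrite -ler_pdivlMl// mulrC.
near: h; apply: cvg_within.
have : `|h| @[h --> (0:R)] --> (0 : R).
  by rewrite -[X in _ --> X](normr0 R); exact: cvg_norm.
by move/cvgrPdist_le => /(_ (e / C)); rewrite divr_gt0// => /(_ isT);
  apply: filterS => h; rewrite sub0r normrN normr_id.
Unshelve. all: by end_near. Qed.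

Lemma is_derive_flat n (t : R) :
  is_derive t 1 (flat n) (flat n.+2 t - n%:R * flat n.+1 t).
Proof.
have [t0|t0|->] := ltgtP t 0.
- rewrite !flat_le0 ?mulr0 ?subr0; [|exact: ltW..].
  have near_eq : \forall s \near t, cst (0:R) s = flat n s.
    near=> s; rewrite flat_le0//; apply: ltW; near: s; exact: lt_nbhsl.
  apply: (near_eq_is_derive near_eq) => //; exact: is_derive_cst.
- have dg : is_derive t 1 (fun s : R => s^-1 ^+ n * expR (- s^-1))
      (flat n.+2 t - n%:R * flat n.+1 t).
    have tN0 : t != 0 by rewrite gt_eqF.
    have dV : is_derive t 1 (fun s : R => s^-1) (- t^-1 ^+ 2).
      have := @is_deriveV R id t 1 1 tN0 (is_derive_id _ _).
      by rewrite /GRing.scale/= mulr1 exprVn.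
    have dX : is_derive t 1 (fun s : R => s^-1 ^+ n)
        (n%:R * t^-1 ^+ n.-1 * (- t^-1 ^+ 2)).
      have := is_deriveX n dV.
      rewrite /GRing.scale/=; congr is_derive.
      by apply/funext => s; rewrite exprfctE.
    have dN : is_derive t 1 (fun s : R => - s^-1) (t^-1 ^+ 2).
      by rewrite -[X in is_derive _ _ _ X]opprK; exact: is_deriveN.
    have dE : is_derive t 1 (fun s : R => expR (- s^-1))
        (t^-1 ^+ 2 * expR (- t^-1)).
      have [dd dEE] := @is_derive1_comp R expR (fun s => - s^-1) t _ _ (is_derive_expR _) dN.
      by apply: DeriveDef => //; rewrite -/(expR \o _) dEE mulrC.
    apply: (is_derive_eq (is_deriveM dX dE)); rewrite /flat t0 /GRing.scale/=.
    case: n {dX} => [|n]; first by rewrite !mul0r !mulr0 !expr0; ring.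
    by rewrite /= !exprS; ring.
  have near_eq : \forall s \near t, (fun s : R => s^-1 ^+ n * expR (- s^-1)) s = flat n s.
    near=> s; rewrite /flat ifT//; near: s; exact: lt_nbhsr.
  exact: (near_eq_is_derive near_eq).
- rewrite !flat_le0// mulr0 subr0; exact: is_derive_flat0.
Unshelve. all: by end_near. Qed.

Lemma flat_smooth n : smooth1 (flat n).
Proof.
move=> m; elim: m n => [//|m IHm] n /=.
exists (fun t => flat n.+2 t - n%:R * flat n.+1 t) => [t|].
  exact: is_derive_flat.
rewrite (_ : (fun _ => _) = flat n.+2 \+ ((fun=> - n%:R) \* flat n.+1)); last first.
  by apply/funext => t /=; rewrite mulNr.
apply: times_derivableD => //.
by apply: times_derivableM => //; exact: times_derivable_cst.
Qed.

End FlatFunctions.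

(** * A smooth step and its derivative *)

Section SmoothStep.
Variable R : realType.

(** The usual smooth transition from 0 (left of -1) to 1 (right of 1).  The
arguments are written [1 * t + 1] and [-1 * t + 1] so that [is_derive_aff] and
[times_derivable_aff] apply.  Its derivative is the bump used below: the point of
starting from the primitive is that the primitive is then explicit. *)
Definition smooth_step (t : R) : R :=
  flat 0 (1 * t + 1) * (flat 0 (1 * t + 1) + flat 0 (-1 * t + 1))^-1.

Definition smooth_step' (t : R) : R :=
  (flat 2 (1 * t + 1) * flat 0 (-1 * t + 1) +
   flat 0 (1 * t + 1) * flat 2 (-1 * t + 1)) *
  (flat 0 (1 * t + 1) + flat 0 (-1 * t + 1))^-1 ^+ 2.

Let den_gt0 (t : R) : 0 < flat 0 (1 * t + 1) + flat 0 (-1 * t + 1).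
Proof.
have [t0|t0] := ltP (-1) t.
  by rewrite ltr_pwDl ?flat_ge0// flat_gt0//; lra.
by rewrite ltr_wpDl ?flat_ge0// flat_gt0//; lra.
Qed.

Lemma smooth_step_smooth : smooth1 smooth_step.
Proof.
move=> n; apply: times_derivableM; first exact/times_derivable_aff/flat_smooth.
apply: times_derivableV; first by move=> t; rewrite gt_eqF.
by apply: times_derivableD; exact/times_derivable_aff/flat_smooth.
Qed.

Lemma is_derive_smooth_step (t : R) : is_derive t 1 smooth_step (smooth_step' t).
Proof.
have aff (a : R) : is_derive t 1 (fun s : R => flat 0 (a * s + 1)) (a * flat 2 (a * t + 1)).
  have := is_derive1_comp (is_derive_flat 0 _) (is_derive_aff a 1 t).
  by rewrite mul0r subr0 mulrC.
have N0 : flat 0 (1 * t + 1) + flat 0 (-1 * t + 1) != 0 by rewrite gt_eqF.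
have dV := @is_deriveV R
  (fun s => flat 0 (1 * s + 1) + flat 0 (-1 * s + 1)) t _ 1 N0 (is_deriveD (aff 1) (aff (-1))).
apply: (is_derive_eq (is_deriveM (aff 1) dV)).
rewrite /smooth_step' /GRing.scale/= -exprVn; field.
by rewrite ?mul1r ?mulN1r in N0 *.
Qed.

Lemma smooth_step'_ge0 t : 0 <= smooth_step' t.
Proof.
by rewrite mulr_ge0 ?sqr_ge0// addr_ge0// mulr_ge0// flat_ge0.
Qed.

Lemma smooth_step'0_gt0 : 0 < smooth_step' 0.
Proof.
rewrite mulr_gt0 ?exprn_gt0 ?invr_gt0//.
by rewrite addr_gt0// mulr_gt0// flat_gt0// !mulr0 add0r.
Qed.

Lemma smooth_step'_out t : 1 <= `|t| -> smooth_step' t = 0.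
Proof.
rewrite ler_normr /smooth_step' => /orP[t1|t1]; last first.
  by rewrite ![flat _ (1 * t + 1)]flat_le0 ?mul0r ?addr0 ?mul0r//; lra.
by rewrite ![flat _ (-1 * t + 1)]flat_le0 ?mulr0 ?addr0 ?mul0r//; lra.
Qed.

Lemma smooth_step_left t : t <= -1 -> smooth_step t = 0.
Proof. by move=> t1; rewrite /smooth_step flat_le0 ?mul0r//; lra. Qed.

Lemma smooth_step_right t : 1 <= t -> smooth_step t = 1.
Proof.
move=> t1; rewrite /smooth_step [flat _ (-1 * t + 1)]flat_le0; last lra.
by rewrite addr0 divff// gt_eqF// flat_gt0//; lra.
Qed.

Lemma smooth_step'E : smooth_step' = fun t => 'D_1 smooth_step t.
Proof.
by apply/funext => t; have := is_derive_smooth_step t => d; rewrite derive_val.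
Qed.

Lemma smooth_step'_smooth : smooth1 smooth_step'.
Proof. by rewrite smooth_step'E; case: (smooth1_derive smooth_step_smooth). Qed.

Lemma smooth_step'_lower : exists c delta : R,
  [/\ 0 < c, 0 < delta & forall t, `|t| < delta -> c <= smooth_step' t].
Proof.
exists (smooth_step' 0 / 2).
have c0 : 0 < smooth_step' 0 / 2 by rewrite divr_gt0// smooth_step'0_gt0.
have /(_ 0) := @smooth1_continuous R _ smooth_step'_smooth.
move=> /cvgrPdist_le/(_ _ c0)/nbhs_ballP[e /= e0 he].
exists e; split => // t te.
have := he t; rewrite /ball/= sub0r normrN => /(_ te).
rewrite ler_norml => /andP[_]; lra.
Qed.

Lemma bounded_continuous_supp (u : R -> R) : continuous u ->
  (forall t, 1 <= `|t| -> u t = 0) ->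
  exists2 M, 1 <= M & forall t, `|u t| <= M.
Proof.
move=> cu u0.
have N11 : (-1 : R) <= 1 by lra.
have [|c _ hc] := @EVT_max R (fun t => `|u t|) (-1) 1 N11.
  apply: continuous_subspaceT => t; apply: continuous_comp; first exact: cu.
  exact: norm_continuous.
exists (1 + `|u c|); first by rewrite lerDl.
move=> t; have [t1|t1] := lerP 1 `|t|; first by rewrite u0// normr0 addr_ge0.
apply: (@le_trans _ _ `|u c|); last by rewrite lerDr.
by apply: hc; rewrite in_itv/=; move: t1; rewrite ltr_norml => /andP[/ltW -> /ltW ->].
Qed.

End SmoothStep.

(** * Product functions on R^d *)

Section Tensor.
Variables (R : realType) (d : nat).
Implicit Types (u p : 'I_d -> R -> R) (x y : 'rV[R]_d) (k : 'I_d).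

Definition tensor u : 'rV[R]_d -> R := fun y => \prod_(j < d) u j (y ord0 j).

(** Deriving a product function in direction k replaces its k-th factor by the
derivative of that factor. *)
Definition slot_derive k u : 'I_d -> R -> R :=
  fun j t => if j == k then 'D_1 (u j) t else u j t.

Lemma slot_derive_smooth k u : (forall j, smooth1 (u j)) ->
  forall j, smooth1 (slot_derive k u j).
Proof.
move=> su j; rewrite /slot_derive; case: eqP => // _.
by have [] := smooth1_derive (su j).
Qed.

Lemma tensorD1 k u y :
  tensor u y = u k (y ord0 k) * \prod_(j < d | j != k) u j (y ord0 j).
Proof. by rewrite /tensor (bigD1 k). Qed.

Lemma tensor_continuous u : (forall j, smooth1 (u j)) -> continuous (tensor u).
Proof.
move=> su; rewrite /tensor; elim: (index_enum _) => [|j s IHs] x.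
  by under eq_fun do rewrite big_nil; exact: cst_continuous.
under eq_fun do rewrite big_cons.
apply: continuousM; last exact: IHs.
by apply: continuous_comp; [exact: coord_continuous|exact: smooth1_continuous].
Qed.

Lemma is_derive_tensor k u y : (forall j, smooth1 (u j)) ->
  is_derive y (delta_mx ord0 k) (tensor u) (tensor (slot_derive k u) y).
Proof.
move=> su; have [/(_ (y ord0 k)) [/cvg_ex [/= l hl] dE] _] := smooth1_derive (su k).
have lE : l = 'D_1 (u k) (y ord0 k) by apply/esym; apply: cvg_lim hl.
set c := \prod_(j < d | j != k) u j (y ord0 j).
suff h : h^-1 *: (tensor u (h *: delta_mx ord0 k + y) - tensor u y) @[h --> 0^']
    --> tensor (slot_derive k u) y.
  by apply: DeriveDef; [apply/cvg_ex; eexists; exact: h|apply: cvg_lim h].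
rewrite (_ : tensor (slot_derive k u) y = c * l); last first.
  rewrite (tensorD1 k) /slot_derive eqxx lE mulrC; congr (_ * _).
  by apply: eq_bigr => j /negbTE ->.
rewrite (_ : (fun h => _) = fun h : R => c *
    (h^-1 *: (u k (h *: 1 + y ord0 k) - u k (y ord0 k)))).
  by apply: cvgM => //; exact: cvg_cst.
apply/funext => h; rewrite !(tensorD1 k) !mxE !eqxx /=.
rewrite (_ : \prod_(j < d | j != k) _ = c); last first.
  by apply: eq_bigr => j jk; rewrite !mxE (negbTE jk) andbF mulr0 add0r.
by rewrite -/c /GRing.scale/=; ring.
Qed.

Lemma partial_tensor k u : (forall j, smooth1 (u j)) ->
  partial k (tensor u) = tensor (slot_derive k u).
Proof.
move=> su; apply/funext => y; rewrite /partial.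
by have := is_derive_tensor k y su => dt; rewrite derive_val.
Qed.

(** Every iterated partial derivative of a product function is again a product
function of smooth factors. *)
Lemma tensor_smooth u : (forall j, smooth1 (u j)) -> smooth (tensor u).
Proof.
move=> su s; have [v sv ->] : exists2 v : 'I_d -> R -> R,
    (forall j, smooth1 (v j)) & iter_partial s (tensor u) = tensor v.
  elim: s => [|k s [v sv ihs]]; first by exists u.
  exists (slot_derive k v); first exact: slot_derive_smooth.
  by rewrite /= ihs partial_tensor.
split; first exact: tensor_continuous.
by move=> j x; have := is_derive_tensor j x sv => dv; exact: ex_derive.
Qed.

(** In a bump the profiles live on the unit interval; the affine change of
variable is written in the form a t + c expected by [times_derivable_aff]. *)
Definition rescale x (r : R) p : 'I_d -> R -> R :=
  fun j t => p j (r^-1 * t + - (r^-1 * x ord0 j)).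

Definition bump x r p := tensor (rescale x r p).

Lemma rescale_smooth x r p : (forall j, smooth1 (p j)) ->
  forall j, smooth1 (rescale x r p j).
Proof. by move=> sp j n; exact: (times_derivable_aff _ _ (sp j n)). Qed.

Lemma bumpE x r p y : bump x r p y = \prod_(j < d) p j (r^-1 * (y ord0 j - x ord0 j)).
Proof. by apply: eq_bigr => j _; rewrite /rescale mulrBr. Qed.

Lemma partial_bump k x r p : (forall j, smooth1 (p j)) ->
  partial k (bump x r p) = fun y => r^-1 * bump x r (slot_derive k p) y.
Proof.
move=> sp; rewrite partial_tensor; last exact: rescale_smooth.
apply/funext => y; rewrite /bump !(tensorD1 k) /slot_derive /rescale eqxx mulrA.
congr (_ * _); last by apply: eq_bigr => j /negbTE ->.
set c := - (r^-1 * x ord0 k).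
have [+ _] := smooth1_derive (sp k).
move=> /(_ (r^-1 * y ord0 k + c)) dp.
have dc := @is_derive1_comp R (p k) (fun t => r^-1 * t + c) _ _ _ dp
  (is_derive_aff _ _ _).
by rewrite mulrC; case: dc => _ <-.
Qed.

Lemma bump_le x r p (M : R) : (forall j t, `|p j t| <= M) ->
  forall y, `|bump x r p y| <= M ^+ d.
Proof.
move=> pM y; rewrite bumpE normr_prod -[X in _ <= _ ^+ X](card_ord d).
rewrite -prodr_const; apply: ler_prod => j _.
by rewrite normr_ge0 pM.
Qed.

(** Outside the closed interval the function is locally constant; at the two
end points the derivative vanishes by continuity. *)
Lemma derive_out (u : R -> R) : smooth1 u -> (forall t, 1 <= `|t| -> u t = 0) ->
  forall t, 1 <= `|t| -> 'D_1 u t = 0.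
Proof.
move=> su u0; have D0 t : 1 < `|t| -> 'D_1 u t = 0.
  move=> t1; rewrite (@near_eq_derive _ _ _ u (cst 0)) ?derive_cst//.
  have : `|s| @[s --> t] --> `|t| by exact: norm_continuous.
  move/cvgrPdist_lt => /(_ (`|t| - 1)); rewrite subr_gt0 => /(_ t1).
  apply: filterS => s; rewrite ltr_norml => /andP[_ h].
  by apply: u0; lra.
move=> t; rewrite le_eqVlt => /orP[/eqP t1|/D0//].
have [_ sD] := smooth1_derive su.
have /(_ t)/cvgrPdist_le cD := smooth1_continuous sD.
apply/eqP; rewrite -normr_le0; apply/ler_addgt0Pl => e e0; rewrite addr0.
have /nbhs_ballP[r /= r0 hr] := cD e e0.
have D0s : 'D_1 u (t * (1 + r / 2)) = 0.
  by apply: D0; rewrite normrM -t1 mul1r ger0_norm; lra.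
have := hr (t * (1 + r / 2)); rewrite /ball/= D0s subr0; apply;
  rewrite mulrDr mulr1 opprD addrA subrr sub0r normrN normrM -t1 mul1r.
rewrite ger0_norm; lra.
Qed.

Lemma slot_derive_out k p : (forall j, smooth1 (p j)) ->
  (forall j t, 1 <= `|t| -> p j t = 0) ->
  forall j t, 1 <= `|t| -> slot_derive k p j t = 0.
Proof.
move=> sp p0 j t t1; rewrite /slot_derive; case: eqP => _; last exact: p0.
by apply: derive_out => // s; exact: p0.
Qed.

Lemma rV_ballP x y (r : R) : 0 < r ->
  ball x r y <-> forall j, `|y ord0 j - x ord0 j| < r.
Proof.
move=> r0; split=> [[_ h] j|h]; first by have := h ord0 j; rewrite /ball/= distrC.
by split=> // i j; rewrite /ball/= !ord1 distrC.
Qed.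

Lemma bump_out x r p : 0 < r -> (forall j t, 1 <= `|t| -> p j t = 0) ->
  forall y, ~ ball x r y -> bump x r p y = 0.
Proof.
move=> r0 p0 y; rewrite (rV_ballP _ _ r0) => /existsNP[j /negP]; rewrite -leNgt => h.
rewrite bumpE (bigD1 j)//= p0 ?mul0r//.
by rewrite normrM gtr0_norm ?invr_gt0// mulrC ler_pdivlMr// mul1r.
Qed.

Lemma closed_cube_compact x (r : R) : compact [set y | `|x - y| <= r].
Proof.
apply: bounded_closed_compact; last exact: closed_closed_ball_.
exists (`|x| + `|r|); split=> [|M xM y /= h]; first exact: num_real.
apply: (le_trans _ (ltW xM)); rewrite -[y](subKr x).
by rewrite (le_trans (ler_normB _ _))// lerD2l (le_trans h)// ler_norm.
Qed.

Lemma test_function_supp (W : set 'rV[R]_d) (f : 'rV[R]_d -> R) x r s :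
  smooth f -> r < s -> ball x s `<=` W ->
  (forall y, ~ ball x r y -> f y = 0) -> test_function W f.
Proof.
move=> sf rs xW f0.
have cl : closure [set y | f y != 0] `<=` [set y | `|x - y| <= r].
  have /closure_id -> : closed [set y | `|x - y| <= r].
    exact: closed_closed_ball_.
  apply: closure_subset => y /= fy; rewrite leNgt; apply/negP => ry.
  move/eqP: fy; apply; apply: f0; rewrite -ball_normE /ball_/= => xy.
  by have := lt_trans ry xy; rewrite ltxx.
split => //.
  apply: (subclosed_compact _ (closed_cube_compact (x := x) (r := r))) cl.
  exact: closed_closure.
apply: subset_trans cl _ => y /= xy; apply: xW.
by rewrite -ball_normE /ball_/=; exact: le_lt_trans rs.
Qed.

End Tensor.

(** * Dilations of a bump *)

Section Dilation.
Variables (R : realType) (d : nat).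

(** The two products are joined by the hybrids that use the factors c before
position m and the factors a from position m on. *)
Lemma prod_telescope (a c : 'I_d -> R) :
  \prod_i a i - \prod_i c i =
  \sum_(j < d) \prod_(i < d)
     (if (i < j)%N then c i else if i == j then a i - c i else a i).
Proof.
pose H m := \prod_(i < d) (if (i < m)%N then c i else a i).
transitivity (\sum_(j < d) (H j - H j.+1)).
  rewrite -(big_mkord xpredT (fun j => H j - H j.+1)).
  rewrite (telescope_sumr_eq (fun m => - H m)) //; last first.
    by move=> k _; rewrite opprK addrC.
  rewrite opprK [RHS]addrC /H; congr (_ - _); apply: eq_bigr => i _.
  by rewrite ltn_ord.
apply: eq_bigr => j _.
have HE m : H m = (if (j < m)%N then c j else a j) *
    \prod_(i < d | i != j) (if (i < m)%N then c i else a i).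
  by rewrite /H (bigD1 j).
rewrite !HE ltnn ltnSn [RHS](bigD1 j)//= ltnn eqxx mulrBl; congr (_ * _ - _ * _).
  by apply: eq_bigr => i /negbTE ->.
apply: eq_bigr => i ij; rewrite ltnS leq_eqVlt (negbTE ij) /=.
by move: ij; rewrite -(inj_eq val_inj)/= => /negbTE ->.
Qed.

Lemma uniform_bound (I : finType) (f : I -> R -> R) :
  (forall i, exists2 M, 1 <= M & forall t, `|f i t| <= M) ->
  exists2 M, 1 <= M & forall i t, `|f i t| <= M.
Proof.
move=> /(_ _)/cid2-/all_sig2[M M1 hM]; exists (1 + \sum_i M i).
  by rewrite lerDl sumr_ge0// => i _; rewrite (le_trans ler01).
move=> i t; rewrite (le_trans (hM i t))// (bigD1 i)//= addrCA lerDl.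
by rewrite addr_ge0// sumr_ge0// => j _; rewrite (le_trans ler01).
Qed.

(** The profiles of the j-th term of the telescoping sum: the undilated bump b
in the slots before j, the dilated bump lam b(lam t) after j, and in slot j the
primitive B(lam t) - B(t) of lam b(lam t) - b(t).  That primitive has compact
support because the two bumps have the same integral. *)
Definition dilation_profile (lam : R) (j i : 'I_d) : R -> R :=
  if (i < j)%N then @smooth_step' R
  else if i == j then fun t => smooth_step (lam * t + 0) - smooth_step t
  else fun t => lam * smooth_step' (lam * t + 0).

Lemma dilation_profile_smooth lam j i : smooth1 (dilation_profile lam j i).
Proof.
have sb := @smooth_step'_smooth R; have sB := @smooth_step_smooth R.
rewrite /dilation_profile; case: ifP => // _; case: ifP => _ n.
  have -> : (fun t => smooth_step (lam * t + 0) - smooth_step t) =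
      (fun t => smooth_step (lam * t + 0)) \+ ((fun=> -1) \* (@smooth_step R)).
    by apply/funext => t /=; rewrite mulN1r.
  apply: times_derivableD; first exact: (times_derivable_aff lam 0 (sB n)).
  by apply: times_derivableM => //; exact: times_derivable_cst.
apply: (@times_derivableM R n (fun=> lam)); first exact: times_derivable_cst.
exact: (times_derivable_aff lam 0 (sb n)).
Qed.

Lemma dilation_profile_out lam j i : 1 <= lam ->
  forall t, 1 <= `|t| -> dilation_profile lam j i t = 0.
Proof.
move=> lam1 t t1; have lt1 : 1 <= `|lam * t + 0|.
  by rewrite addr0 normrM (ger0_norm (le_trans _ lam1))// (le_trans t1)// ler_peMl.
rewrite /dilation_profile; case: ifP => _; first exact: smooth_step'_out.
case: ifP => _; last by rewrite smooth_step'_out// mulr0.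
move: t1; rewrite ler_normr => /orP[t1|t1].
  rewrite !smooth_step_right ?subrr// addr0 (le_trans t1)// ler_peMl//; lra.
rewrite !smooth_step_left ?subrr//; first lra.
rewrite addr0 lerNr -mulrN (le_trans t1)// ler_peMl//; lra.
Qed.

Lemma slot_derive_dilation lam j t :
  slot_derive j (dilation_profile lam j) j t =
  lam * smooth_step' (lam * t + 0) - smooth_step' t.
Proof.
rewrite /slot_derive eqxx.
have dB := is_derive_smooth_step.
have dc := @is_derive1_comp R (@smooth_step R) (fun t => lam * t + 0) _ _ _ (dB _ _)
  (is_derive_aff lam 0 t).
have := is_deriveB dc (dB _ t) => ds.
rewrite (_ : dilation_profile lam j j = (@smooth_step R) \o (fun t => lam * t + 0) -
   @smooth_step R); first by case: ds => _ ->; congr (_ - _); exact: mulrC.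
by apply/funext => s; rewrite /dilation_profile ltnn eqxx.
Qed.

(** A measure whose derivatives are small gives nearly the same integral to a bump
and to its normalized dilation.  The factor r on the right is the one that a
derivative at scale r costs, so the error is of the order of the derivatives of
profiles of size 1. *)
Lemma dilation_identity lam (x : 'rV[R]_d) r y : 0 < r ->
  lam ^+ d * bump x r (fun=> fun t => smooth_step' (lam * t + 0)) y -
  bump x r (fun=> @smooth_step' R) y =
  r * \sum_(j < d) partial j (bump x r (dilation_profile lam j)) y.
Proof.
move=> r0; rewrite !bumpE -[X in lam ^+ X](card_ord d) -prodr_const -big_split/=.
rewrite prod_telescope mulr_sumr; apply: eq_bigr => j _.
rewrite partial_bump; last by move=> i; exact: dilation_profile_smooth.
rewrite mulrA divff ?gt_eqF// mul1r bumpE; apply: eq_bigr => i _.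
have [->|ij] := eqVneq i j; first by rewrite ltnn slot_derive_dilation.
by rewrite /slot_derive /dilation_profile (negbTE ij); case: ifP.
Qed.

Lemma dilation_profile_bounded lam : 1 <= lam ->
  exists2 M, 1 <= M &
    (forall j i t, `|dilation_profile lam j i t| <= M) /\
    (forall k j i t, `|slot_derive k (dilation_profile lam j) i t| <= M).
Proof.
move=> lam1; have sp := dilation_profile_smooth lam.
pose f (a : option 'I_d * 'I_d * 'I_d) := match a.1.1 with
  | None => dilation_profile lam a.1.2 a.2
  | Some k => slot_derive k (dilation_profile lam a.1.2) a.2 end.
have [[[k j] i]|M M1 hM] := @uniform_bound _ f.
  apply: bounded_continuous_supp.
    apply: smooth1_continuous; rewrite /f; case: k => [k|]//=.
    by apply: slot_derive_smooth => ?; exact: sp.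
  rewrite /f/=; case: k => [k|] t t1; last exact: dilation_profile_out.
  apply: slot_derive_out t1; first exact: sp.
  by move=> ? s s1; exact: dilation_profile_out.
exists M => //; split=> [j i t|k j i t]; first exact: (hM (None, j, i)).
exact: (hM (Some k, j, i)).
Qed.

End Dilation.

(** * Finite Borel measures on R^d *)

Section FiniteMeasures.
Context d (T : measurableType d) (R : realType).
Local Open Scope ereal_scope.

Lemma decreasing_cap0_small (mu : {finite_measure set T -> \bar R})
    (F : (set T)^nat) (e : R) :
  (forall n, measurable (F n)) -> nonincreasing_seq F -> \bigcap_n F n = set0 ->
  (0 < e)%R -> exists n, mu (F n) < e%:E.
Proof.
move=> mF dF F0 e0.
have : mu \o F @ \oo --> mu (\bigcap_n F n).
  apply: nonincreasing_cvg_mu => //; last by rewrite F0.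
  by rewrite ltey_eq fin_num_measure.
rewrite F0 measure0 => cF.
have /fine_cvgP[_ /cvgrPdist_lt/(_ _ e0)[n _ /(_ n (leqnn n))]] := cF.
rewrite sub0r normrN /= ger0_norm ?fine_ge0// => hn; exists n.
by rewrite -(fineK (fin_num_measure _ _ (mF n))) lte_fin.
Qed.

Lemma negligible_small_cover (mu : {measure set T -> \bar R}) (S : set T) :
  (forall e : R, (0 < e)%R -> exists V, [/\ measurable V, S `<=` V & mu V <= e%:E]) ->
  mu.-negligible S.
Proof.
move=> h.
have /choice[V hV] : forall n, exists V,
    [/\ measurable V, S `<=` V & mu V <= (n.+1%:R^-1)%:E].
  by move=> n; apply: h; rewrite invr_gt0.
have mV : measurable (\bigcap_n V n).
  by apply: bigcap_measurable => // n _; have [] := hV n.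
exists (\bigcap_n V n); split => //; last first.
  by move=> x Sx n _; have [_ SV _] := hV n; exact: SV.
apply/eqP; rewrite eq_le measure_ge0 andbT; apply/lee_addgt0Pr => e e0.
have [n ne] : exists n, (n.+1%:R^-1 < e)%R.
  have [n _ hn] := near_infty_natSinv_lt (PosNum e0).
  by exists n; exact: (hn n (leqnn n)).
rewrite add0e; have [mVn _ le_n] := hV n.
apply: (@le_trans _ _ (mu (V n))); last by rewrite (le_trans le_n)// lee_fin ltW.
by apply: le_measure; rewrite ?inE// => x; apply.
Qed.

Lemma exists_dominating_measure n (m : 'I_n -> {finite_measure set T -> \bar R}) :
  exists mu : {finite_measure set T -> \bar R},
    forall i A, measurable A -> m i A <= mu A.
Proof.
elim: n m => [m|n IHn m]; first by exists mzero => -[].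
have [nu hnu] := IHn (fun i => m (lift ord0 i)).
pose nu' := measure_add nu (m ord0).
have fin : nu' setT < +oo.
  by rewrite /nu' measure_addE lte_add_pinfty// ltey_eq fin_num_measure.
(* restricting to setT changes nothing but gives a finite measure structure *)
exists (mfrestr measurableT fin) => i A mA.
rewrite [leRHS](_ : _ = nu A + m ord0 A); last first.
  transitivity (nu' (A `&` setT)); first by [].
  by rewrite setIT /nu' measure_addE.
case: (unliftP ord0 i) => [j ->|->]; last by rewrite leeDr.
by rewrite (le_trans (hnu j _ mA))// leeDl.
Qed.

End FiniteMeasures.

Section BorelRegularity.
Variables (R : realType) (d : nat).
Local Notation T := (borel R d).

Lemma borel_open (U : set 'rV[R]_d) : open U -> measurable (U : set T).
Proof. by move=> oU; exact: sub_sigma_algebra. Qed.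

Lemma borel_closed (U : set 'rV[R]_d) : closed U -> measurable (U : set T).
Proof. by move=> /closed_openC/borel_open/measurableC; rewrite setCK. Qed.

Lemma borel_ball (x : 'rV[R]_d) r : measurable (ball x r : set T).
Proof.
by apply: borel_open; exact: ball_open.
Qed.

Lemma borel_continuous (f : 'rV[R]_d -> R) : continuous f ->
  measurable_fun setT (f : T -> R).
Proof.
move=> /continuousP cf; apply: (measurability _ (RGenOInfty.measurableE R)).
move=> _ [_ [a ->] <-]; rewrite setTI; apply: borel_open.
exact/cf/interval_open.
Qed.

Variable mu : {finite_measure set T -> \bar R}.

Lemma fine_measure_ball_le (x : 'rV[R]_d) (r s : R) : r <= s ->
  fine (mu (ball x r)) <= fine (mu (ball x s)).
Proof.
move=> rs; apply: fine_le; rewrite ?fin_num_measure//; [exact: borel_ball..|].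
by apply: le_measure; rewrite ?inE; [exact: borel_ball..|exact: le_ball].
Qed.

(** Regularity of finite Borel measures, stated symmetrically in a set and its
complement so that complements are free in the induction on the sigma-algebra:
the closed set inside [E] is the complement of [V]. *)
Lemma sandwich_open (E : set T) : measurable E -> forall e : R, 0 < e ->
  exists U V : set 'rV[R]_d, [/\ open U, open V, E `<=` U, ~` E `<=` V &
    (mu (U `&` V) < e%:E)%E].
Proof.
pose M := [set A : set T | measurable A /\ forall e : R, 0 < e ->
  exists U V : set 'rV[R]_d, [/\ open U, open V, A `<=` U, ~` A `<=` V &
    (mu (U `&` V) < e%:E)%E]].
suff : measurable `<=` M by move=> h /h[].
apply: smallest_sub; last first.
  move=> A oA; split=> [|e e0]; first exact: borel_open.
  (* the open neighbourhoods of ~` A shrink to ~` A, because A is open *)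
  pose V n := \bigcup_(y in ~` A) ball y (n.+1%:R^-1).
  have oV n : open (V n) by apply: bigcup_open => y _; exact: ball_open.
  have [n hn] : exists n, (mu (A `&` V n) < e%:E)%E.
    apply: decreasing_cap0_small => //.
    - by move=> n; apply: borel_open; apply: openI.
    - move=> m n mn; apply/subsetPset; apply: setIS => x [y Ay yx].
      exists y => //; apply: le_ball yx.
      by rewrite lef_pV2 ?posrE// ler_nat.
    - rewrite -subset0 => x hx; have [Ax _] := hx 0%N I.
      have /nbhs_ballP[r /= r0 hr] : nbhs x A by exact: open_nbhs_nbhs.
      have [n nr] : exists n, (n.+1%:R^-1 < r).
        have [n _ hn] := near_infty_natSinv_lt (PosNum r0).
        by exists n; exact: (hn n (leqnn n)).
      have [_ [y Ay yx]] := hx n I; apply: Ay; apply: hr.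
      by apply/ball_sym; apply: le_ball yx; exact: ltW.
  exists A, (V n); split => // y Ay; exists y => //; exact: ballxx.
split.
- split=> // e e0; exists set0, setT; split => //.
  + exact: openT.
  + by rewrite set0I measure0 lte_fin.
- move=> A [mA hA]; rewrite setTD; split=> [|e e0]; first exact: measurableC.
  have [U [V [oU oV AU AV UV]]] := hA e e0.
  by exists V, U; split => //; rewrite ?setCK// setIC.
suff step (A : (set T)^nat) : (forall n, M (A n)) -> M (\bigcup_k A k) by exact: step.
move=> hA; have mA n : measurable (A n) := (hA n).1.
split=> [|e e0]; first exact: bigcupT_measurable.
have e20 : 0 < e / 2 by rewrite divr_gt0.
have e2 n : 0 < (e / 2) / (2 ^ n.+1)%:R by rewrite divr_gt0// ltr0n expn_gt0.
have /choice[U /choice[V hUV]] := fun n => (hA n).2 _ (e2 n).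
pose C : set T := \bigcup_n (U n `&` V n).
have oUn n : open (U n) by have [] := hUV n.
have oVn n : open (V n) by have [] := hUV n.
have oC n : open (U n `&` V n) by exact: openI.
have mC : measurable C by apply: borel_open; exact: bigcup_open.
(* A point of the open sets chosen below that lies outside C belongs to some A m
   but to none of the first n sets, hence to D n. *)
pose D n : set T := (\bigcup_k A k) `\` \bigcup_(k < n) A k.
have mD n : measurable (D n).
  by apply: measurableD; exact: bigcup_measurable.
have [n hn] : exists n, (mu (D n) < (e / 2)%:E)%E.
  apply: decreasing_cap0_small => //.
    move=> m n mn; apply/subsetPset; apply: setDS => x [k /= km Akx].
    by exists k => //=; exact: leq_trans mn.
  rewrite -subset0 => x hx; have [[k _ Akx] _] := hx 0%N I.
  by have [_] := hx k.+1 I; apply; exists k => /=.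
exists (\bigcup_k U k), (\bigcap_(k < n) V k); split.
- exact: bigcup_open.
- by rewrite bigcap_mkord; elim/big_ind: _ => //; [exact: openT|exact: openI].
- by move=> x [k _ Akx]; exists k => //; have [_ _ + _ _] := hUV k; apply.
- move=> x nAx k _; have [_ _ _ + _] := hUV k; apply => Akx.
  by apply: nAx; exists k.
have mUV : measurable (\bigcup_k U k `&` \bigcap_(k < n) V k : set T).
  apply: borel_open; apply: openI; first exact: bigcup_open.
  by rewrite bigcap_mkord; elim/big_ind: _ => //; [exact: openT|exact: openI].
apply: (@le_lt_trans _ _ (mu (C `|` D n))).
  apply: le_measure; rewrite ?inE//; first exact: measurableU.
  move=> x [[m _ Umx] Vx].
  have [Cx|nCx] := pselect (C x); [by left|right; split].
    exists m => //; apply: contrapT => nAm; apply: nCx; exists m => //; split => //.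
    by have [_ _ _ + _] := hUV m; apply.
  move=> [k /= kn Akx]; apply: nCx; exists k => //; split; last exact: Vx.
  by have [_ _ + _ _] := hUV k; apply.
apply: (le_lt_trans (measureU2 _ _ _)) => //.
rewrite [e]splitr EFinD lee_ltD// ?fin_num_measure//.
apply: (@le_trans _ _ (\sum_(k <oo) mu (U k `&` V k)))%E.
  by apply: measure_sigma_subadditive => // k; exact: borel_open.
apply: le_trans (epsilon_trick0 xpredT (ltW e20)).
apply: lee_nneseries => // k _; apply: ltW.
by have [] := hUV k.
Qed.

End BorelRegularity.

(** * Density points *)

Section Differentiation.
Variables (R : realType) (d : nat).
Local Notation T := (borel R d).
Local Notation V := 'rV[R]_d.
Local Open Scope ereal_scope.

Lemma measure_bigcup_seq_le (mu : {finite_measure set T -> \bar R}) (I : countType)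
    (D : set I) (F : I -> set T) (b : \bar R) : (forall i, measurable (F i)) ->
  (forall s : seq I, (forall i, i \in s -> D i) ->
     mu (\bigcup_(i in [set` s]) F i) <= b) ->
  mu (\bigcup_(i in D) F i) <= b.
Proof.
move=> mF hb.
pose s N : seq I := [seq i <- pmap unpickle (iota 0 N) | `[< D i >]].
pose G N := \bigcup_(i in [set` s N]) F i.
have mG N : measurable (G N) by exact: fin_bigcup_measurable.
have -> : \bigcup_(i in D) F i = \bigcup_N G N.
  apply/seteqP; split=> [x [i Di Fx]|x [N _ [i + Fx]]]; last first.
    by rewrite /= mem_filter => /andP[/asboolP Di _]; exists i.
  exists (pickle i).+1 => //; exists i => //=.
  rewrite mem_filter; apply/andP; split; first exact/asboolP.
  by rewrite mem_pmap; apply/mapP; exists (pickle i); rewrite ?mem_iota ?add0n ?ltnSn ?pickleK.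
have cG : mu \o G @ \oo --> mu (\bigcup_N G N).
  apply: nondecreasing_cvg_mu => //; first exact: bigcupT_measurable.
  move=> m n mn; apply/subsetPset => x [i /= + Fx].
  rewrite mem_filter => /andP[Di im]; exists i => //=.
  rewrite mem_filter Di/=; move: im; rewrite !mem_pmap => /mapP[k + ->].
  rewrite mem_iota => /andP[_ km]; apply/mapP; exists k => //.
  by rewrite mem_iota/= (leq_trans km).
rewrite -(cvg_lim _ cG)//; apply: lime_le; first by apply/cvg_ex; eexists; exact: cG.
near=> N; apply: hb => i; by rewrite mem_filter => /andP[/asboolP].
Unshelve. all: by end_near. Qed.

(** The finite Vitali covering argument, carried out directly on measures: take
the ball B of largest radius.  The balls that meet B lie in its threefold
enlargement, and the others are disjoint from B, so that their nu-measure adds up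
with that of B. *)
Lemma vitali_measure (mu nu : {finite_measure set T -> \bar R}) (c : R)
    (s : seq (V * R)) : (0 <= c)%R ->
  (forall p, p \in s -> (0 < p.2)%R /\
     mu (ball p.1 (3 * p.2)) <= c%:E * nu (ball p.1 p.2)) ->
  mu (\bigcup_(p in [set` s]) ball p.1 p.2) <=
  c%:E * nu (\bigcup_(p in [set` s]) ball p.1 p.2).
Proof.
move=> c0; move: {2}(size s) (leqnn (size s)) => n.
have mB (t : seq (V * R)) : measurable (\bigcup_(p in [set` t]) ball p.1 p.2 : set T).
  by apply: fin_bigcup_measurable => // p _; exact: borel_ball.
have nil0 : \bigcup_(p in [set` [::]]) ball p.1 p.2 = set0 :> set V.
  by rewrite -subset0 => x [].
elim: n s => [|n IHn] s sn hs.
  by move: sn; rewrite leqn0 => /nilP ->; rewrite nil0 !measure0 mule0.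
have [/nilP ->|s0] := boolP (nilp s); first by rewrite nil0 !measure0 mule0.
have [p ps pmax] : exists2 p, p \in s & forall q, q \in s -> (q.2 <= p.2)%R.
  clear -s0; elim: s s0 => // p s IHs _; have [/nilP ->|/IHs[q qs qmax]] := boolP (nilp s).
    by exists p; rewrite ?mem_head// => q; rewrite inE => /eqP ->.
  have [qp|pq] := leP q.2 p.2.
    exists p; first by rewrite mem_head.
    move=> q'; rewrite inE => /orP[/eqP ->//|/qmax h]; exact: le_trans qp.
  exists q; first by rewrite inE qs orbT.
  by move=> q'; rewrite inE => /orP[/eqP ->|/qmax//]; exact: ltW.
pose t := [seq q <- s | `[< ball q.1 q.2 `&` ball p.1 p.2 = set0 >]].
have [p0 hp] := hs p ps.
have ht : mu (\bigcup_(q in [set` t]) ball q.1 q.2) <=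
    c%:E * nu (\bigcup_(q in [set` t]) ball q.1 q.2).
  apply: IHn => [|q]; last by rewrite mem_filter => /andP[_ /hs].
  rewrite -ltnS (leq_trans _ sn)// size_filter
    -(count_predC (fun q => `[< ball q.1 q.2 `&` ball p.1 p.2 = set0 >]) s).
  rewrite -[X in (X < _)%N]addn0 ltn_add2l -has_count; apply/hasP; exists p => //=.
  apply/asboolPn => /seteqP[+ _] => /(_ p.1); rewrite setIid => /(_ (ballxx _ p0)).
  by [].
apply: (@le_trans _ _ (mu (ball p.1 (3 * p.2) `|` \bigcup_(q in [set` t]) ball q.1 q.2))).
  apply: le_measure; rewrite ?inE//; first by apply: measurableU => //; exact: borel_ball.
  move=> y [q /= qs qy].
  have [qp|/eqP/set0P[z [qz pz]]] := pselect (ball q.1 q.2 `&` ball p.1 p.2 = set0).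
    by right; exists q => //=; rewrite mem_filter qs andbT; exact/asboolP.
  left; apply: (@le_ball _ _ _ (p.2 + q.2 + q.2)).
    by have := pmax q qs; lra.
  by apply: ball_triangle qy; apply: ball_triangle pz _; exact: ball_sym.
have mp : measurable (ball p.1 p.2 : set T) by exact: borel_ball.
apply: (le_trans (measureU2 _ _ _)) => //; first exact: borel_ball.
apply: (le_trans (leeD hp ht)).
rewrite -ge0_muleDr//; apply: lee_wpmul2l; first by rewrite lee_fin.
rewrite -measureU//.
  apply: le_measure; rewrite ?inE//; first exact: measurableU.
  move=> y [py|[q /= + qy]]; first by exists p.
  by rewrite mem_filter => /andP[_ qs]; exists q.
rewrite -subset0 => y [py [q /= + qy]].
rewrite mem_filter => /andP[/asboolP h _].
by have : (ball q.1 q.2 `&` ball p.1 p.2) y by []; rewrite h.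
Qed.

Lemma rational_ball (x : V) (r : R) : (0 < r)%R ->
  exists (c : 'rV[rat]_d) (q : rat),
    [/\ (2 * r < ratr q < 3 * r)%R & ball x r (map_mx ratr c)].
Proof.
move=> r0.
have /choice[c hc] : forall j : 'I_d, exists a : rat,
    (x ord0 j - r < ratr a < x ord0 j + r)%R.
  move=> j; have /rat_in_itvoo[a] : (x ord0 j - r < x ord0 j + r)%R by lra.
  by rewrite in_itv => ha; exists a.
have /rat_in_itvoo[q] : (2 * r < 3 * r)%R by lra.
rewrite in_itv => hq; exists (\row_j c j), q; split => //.
apply/rV_ballP => // j; rewrite !mxE ltr_distlC.
by have := hc j; rewrite ltrBlDr => /andP[h1 h2]; apply/andP; split; lra.
Qed.

Variable mu : {finite_measure set T -> \bar R}.

(** The exceptional set is covered by balls of rational centre and radius inside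
an open set U around E with mu(U \ E) small; [vitali_measure] bounds the measure
of their union.  The ball is enlarged on the left of the inequality because
[mu] need not be doubling: the factor 10 accounts for the factor 3 of the
covering argument and for the passage to rational balls of up to three times
the radius. *)
Lemma density_at_scale (E : set T) (e : R) : measurable E -> (0 < e)%R ->
  mu.-negligible [set x : T | E x /\ forall r0 : R, (0 < r0)%R -> exists r : R,
    [/\ (0 < r)%R, (r < r0)%R & e%:E * mu (ball x (10 * r)) < mu (ball x r `\` E)]].
Proof.
move=> mE e0; apply: negligible_small_cover => eta eta0.
have ee0 : (0 < e * eta)%R by rewrite mulr_gt0.
have [U [W [oU oW EU EW UW]]] := sandwich_open mu mE ee0.
have mU : measurable (U : set T) by exact: borel_open.
have fin : mu (~` E) < +oo by rewrite ltey_eq fin_num_measure//; exact: measurableC.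
pose nu : {finite_measure set T -> \bar R} := mfrestr (measurableC mE) fin.
have nuE A : nu A = mu (A `\` E) by [].
have nuU : nu U <= (e * eta)%:E.
  rewrite nuE (le_trans _ (ltW UW))//; apply: le_measure; rewrite ?inE.
  - exact: measurableD.
  - by apply: measurableI => //; exact: borel_open.
  - by move=> x [Ux nEx]; split => //; exact: EW.
pose cb (p : 'rV[rat]_d * rat) : V * R := (map_mx ratr p.1, ratr p.2).
pose D := [set p : 'rV[rat]_d * rat | [/\ (0 < (cb p).2)%R, ball (cb p).1 (cb p).2 `<=` U &
  mu (ball (cb p).1 (3 * (cb p).2)) <= (e^-1)%:E * nu (ball (cb p).1 (cb p).2)]].
exists (\bigcup_(p in D) ball (cb p).1 (cb p).2); split.
- apply: borel_open; apply: bigcup_open => p _; exact: ball_open.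
- move=> x [Ex hx].
  have /nbhs_ballP[rho /= rho0 hrho] : nbhs (x : V) U.
    by apply: open_nbhs_nbhs; split => //; exact: EU.
  have [|r [r0 rr hr]] := hx (rho / 4)%R; first by rewrite divr_gt0.
  have [c [q [/andP[q2 q3] xc]]] := rational_ball x r0.
  have cx : ball (map_mx ratr c : V) r x by exact: ball_sym.
  exists (c, q) => /=; last by apply: le_ball cx; lra.
  split => /=; first lra.
    move=> y cy; apply: hrho; have := ball_triangle xc cy.
    by apply: le_ball; lra.
  rewrite muleC lee_pdivlMr//.
  apply: le_trans (_ : mu (ball x r `\` E) <= _); last first.
    rewrite nuE; apply: le_measure; rewrite ?inE.
    + by apply: measurableD => //; exact: borel_ball.
    + by apply: measurableD => //; exact: borel_ball.
    + apply: setSD => y xy; have := ball_triangle cx xy.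
      by apply: le_ball; lra.
  apply: le_trans (ltW hr); rewrite muleC lee_pmul2l ?lte_fin//.
  apply: le_measure; rewrite ?inE; [exact: borel_ball..|].
  by move=> y cy; have := ball_triangle xc cy; apply: le_ball; lra.
- apply: measure_bigcup_seq_le => [p|s sD]; first exact: borel_ball.
  rewrite (_ : \bigcup_(i in _) _ = \bigcup_(p in [set` map cb s]) ball p.1 p.2); last first.
    apply/seteqP; split=> x [p /= ps px].
      by exists (cb p) => //=; exact: map_f.
    by move/mapP : ps => [p' ps' ?]; subst p; exists p'.
  apply: (@le_trans _ _ ((e^-1)%:E * nu (\bigcup_(p in [set` map cb s]) ball p.1 p.2))).
    apply: vitali_measure; first by rewrite invr_ge0 ltW.
    by move=> _ /mapP[p /sD[p0 _ hp] ->].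
  apply: (@le_trans _ _ ((e^-1)%:E * (e * eta)%:E)); last first.
    by rewrite -EFinM mulKf ?gt_eqF.
  apply: lee_wpmul2l; first by rewrite lee_fin invr_ge0 ltW.
  apply: le_trans nuU.
  apply: le_measure; rewrite ?inE//.
    by apply: fin_bigcup_measurable => // p _; exact: borel_ball.
  by move=> x [_ /= /mapP[p /sD[_ hU _] ->]]; exact: hU.
Qed.

Lemma enlarged_density (E : set T) : measurable E ->
  {ae mu, forall x, E x -> forall e : R, (0 < e)%R -> exists2 r0 : R, (0 < r0)%R &
    forall r : R, (0 < r < r0)%R ->
      mu (ball x r `\` E) <= e%:E * mu (ball x (10 * r))}.
Proof.
move=> mE.
have : {ae mu, forall x, forall n, E x -> exists2 r0 : R, (0 < r0)%R &
    forall r : R, (0 < r < r0)%R ->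
      mu (ball x r `\` E) <= (n.+1%:R^-1)%:E * mu (ball x (10 * r))}.
  apply: ae_foralln => n.
  have n0 : (0 < n.+1%:R^-1 :> R)%R by rewrite invr_gt0.
  apply: (negligibleS _ (density_at_scale mE n0)) => x /= /not_implyP[Ex].
  move=> nh; split => // r0 r00; apply: contrapT => nr; apply: nh.
  exists r0 => // r /andP[r1 r2]; rewrite leNgt; apply/negP => hr.
  by apply: nr; exists r.
apply: filterS => x hx Ex e e0.
have [n _ hn] := near_infty_natSinv_lt (PosNum e0).
have [r0 r00 hr] := hx n Ex; exists r0 => // r rr.
apply: (le_trans (hr r rr)); apply: lee_wpmul2r => //.
by rewrite lee_fin ltW//; exact: (hn n (leqnn n)).
Qed.

End Differentiation.

(** * Lebesgue points *)

Section LebesguePoints.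
Variables (R : realType) (d : nat).
Local Notation T := (borel R d).
Local Open Scope ereal_scope.
Variable mu : {finite_measure set T -> \bar R}.

(** [f] is within 2/(n+1) of [f x] on a set of the form |f - q| < 1/(n+1), with q
rational, that contains x.  Only countably many such sets occur, so almost every
x is a density point of all those containing it; what remains of the ball is small
in measure, and the bound on the integrals of |f| turns this into a bound for the
integral of |f| over it. *)
Lemma enlarged_lebesgue_point (f : T -> R) : measurable_fun setT f ->
  (forall A, measurable A -> \int[mu]_(x in A) `|f x|%:E <= mu A) ->
  {ae mu, forall x, forall e : R, (0 < e)%R -> exists2 r0 : R, (0 < r0)%R &
    forall r : R, (0 < r < r0)%R ->
      \int[mu]_(y in ball x r) `|f y - f x|%:E <= e%:E * mu (ball x (10 * r))}.
Proof.
move=> mf fmu.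
pose E (p : rat * nat) : set T := [set y | `|f y - ratr p.1| < p.2.+1%:R^-1]%R.
have mE p : measurable (E p).
  rewrite (_ : E p = (fun y => `|f y - ratr p.1|)%R @^-1` `]-oo, (p.2.+1%:R^-1)%R[%classic).
    rewrite -[X in measurable X]setTI.
    apply: (measurableT_comp (@normr_measurable R setT)) => //.
    by apply: measurable_funB.
  by apply/seteqP; split=> y; rewrite /= in_itv.
have : {ae mu, forall x, forall k : nat, if unpickle k is Some p then E p x ->
    forall e : R, (0 < e)%R -> exists2 r0 : R, (0 < r0)%R & forall r : R, (0 < r < r0)%R ->
      mu (ball x r `\` E p) <= e%:E * mu (ball x (10 * r)) else True}.
  apply: ae_foralln => k; case: (unpickle k) => [p|]; last exact: aeW.
  exact: enlarged_density.
apply: filterS => x hx e e0.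
have e40 : (0 < e / 4)%R by rewrite divr_gt0.
have [n _ /(_ n (leqnn n)) hn] := near_infty_natSinv_lt (PosNum e40).
set s : R := (n.+1%:R^-1)%R in hn *.
have s0 : (0 < s)%R by rewrite invr_gt0.
have /rat_in_itvoo[q] : (f x - s < f x + s)%R by lra.
rewrite in_itv/= => /andP[q1 q2].
have Ex : E (q, n) x by rewrite /E/= -/s ltr_distlC q1 q2.
have c0 : (0 < e / (2 * (1 + `|f x|)))%R.
  by rewrite divr_gt0// mulr_gt0// ltr_pwDl.
have := hx (pickle (q, n)); rewrite pickleK => /(_ Ex _ c0)[r0 r00 hr].
exists r0 => // r rr.
have mB : measurable (ball x r : set T) by exact: borel_ball.
have mB10 : measurable (ball x (10 * r) : set T) by exact: borel_ball.
have mBE : measurable (ball x r `&` E (q, n) : set T) by exact: measurableI.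
have mBD : measurable (ball x r `\` E (q, n) : set T) by exact: measurableD.
have mg A : measurable_fun A (fun y => `|f y - f x|%:E).
  apply/measurable_EFinP; apply: measurable_funTS.
  apply: (measurableT_comp (@normr_measurable R setT)) => //.
  exact: measurable_funB.
rewrite -(setUIDK (ball x r) (E (q, n))) ge0_integral_setU//; last first.
  by rewrite disj_set2E; apply/eqP; rewrite -subset0 => y [[_ ?] [_]].
have -> : e%:E = (e / 2)%:E + (e / 2)%:E :> \bar R by rewrite -EFinD -splitr.
have e2 : (0 <= e / 2)%R by rewrite divr_ge0// ltW.
rewrite ge0_muleDl ?lee_fin//.
apply: leeD.
  apply: (@le_trans _ _ (\int[mu]_(y in ball x r `&` E (q, n)) (e / 2)%:E)).
    apply: ge0_le_integral => //.
    move=> y [_ hy]; rewrite lee_fin (le_trans (ler_distD (ratr q) _ _))//.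
    have hys : (`|f y - ratr q| < s)%R := hy.
    have hxs : (`|ratr q - f x| < s)%R by rewrite distrC; exact: Ex.
    by move: hn => /= hn; lra.
  rewrite integral_cst//; apply: lee_wpmul2l; first by rewrite lee_fin.
  apply: le_measure; rewrite ?inE// => y [+ _]; apply: le_ball.
  by case/andP: rr => *; lra.
apply: (@le_trans _ _ ((1 + `|f x|)%:E * mu (ball x r `\` E (q, n)))).
  apply: (@le_trans _ _ (\int[mu]_(y in ball x r `\` E (q, n)) (`|f y|%:E + `|f x|%:E))).
    apply: ge0_le_integral => //.
    - apply: emeasurable_funD => //; apply/measurable_EFinP; apply: measurable_funTS.
      exact: (measurableT_comp (@normr_measurable R setT)).
    - by move=> y _; rewrite -EFinD lee_fin ler_normB.
  rewrite ge0_integralD//; last first.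
    apply/measurable_EFinP; apply: measurable_funTS.
    exact: (measurableT_comp (@normr_measurable R setT)).
  rewrite integral_cst// EFinD ge0_muleDl ?lee_fin// mul1e leeD2r//.
  exact: fmu.
apply: (@le_trans _ _ ((1 + `|f x|)%:E * ((e / (2 * (1 + `|f x|)))%:E * mu (ball x (10 * r))))).
  by apply: lee_wpmul2l; [rewrite lee_fin addr_ge0|exact: hr].
rewrite muleA -EFinM.
rewrite (_ : (1 + `|f x|) * (e / (2 * (1 + `|f x|))) = e / 2)%R//.
have : (1 + `|f x| != 0 :> R)%R by rewrite gt_eqF// ltr_pwDl.
by move: (1 + `|f x|)%R => a a0; field.
Qed.

End LebesguePoints.

(** * Almost translation invariance at a Lebesgue point *)

Section RealIntegrals.
Context d (T : measurableType d) (R : realType).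
Variable mu : {finite_measure set T -> \bar R}.
Implicit Types (f g : T -> R) (D : set T).

Lemma bounded_set_le (U : Type) (f : U -> R) (D : set U) (M : R) :
  (forall y, `|f y| <= M) -> [bounded f x | x in D].
Proof.
move=> fM; exists M; split; first exact: num_real.
by move=> N MN y _; apply: le_trans (fM y) _; exact: ltW.
Qed.

Lemma bounded_integrable f (M : R) D : measurable D -> measurable_fun setT f ->
  (forall y, `|f y| <= M) -> mu.-integrable D (EFin \o f).
Proof.
move=> mD mf fM; apply: measurable_bounded_integrable => //.
- by rewrite ltey_eq fin_num_measure.
- exact: measurable_funTS.
- exact: (bounded_set_le D fM).
Qed.

Lemma bounded_integrableM f g (M : R) : measurable_fun setT f ->
  (forall y, `|f y| <= M) -> mu.-integrable setT (EFin \o g) ->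
  mu.-integrable setT (EFin \o (fun y => f y * g y)).
Proof.
move=> mf fM ig.
exact: (integrableMr measurableT mf (bounded_set_le setT fM) ig).
Qed.

Lemma Rintegral_sum (I : Type) (s : seq I) (f : I -> T -> R) :
  (forall i, mu.-integrable setT (EFin \o f i)) ->
  \int[mu]_x (\sum_(i <- s) f i x) = \sum_(i <- s) \int[mu]_x f i x.
Proof.
move=> hf; elim: s => [|i s IHs].
  rewrite big_nil; under eq_Rintegral do rewrite big_nil.
  by rewrite Rintegral_cst// mul0r.
rewrite big_cons -IHs -RintegralD//.
  by apply: eq_Rintegral => x _; rewrite big_cons.
rewrite (_ : EFin \o _ = fun x => (\sum_(i <- s) (EFin \o f i) x)%E); last first.
  by apply/funext => x; rewrite /= sumEFin.
exact: integrable_sum.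
Qed.

Lemma Rintegral_supp (m : {measure set T -> \bar R}) f D : measurable D ->
  (forall y, ~ D y -> f y = 0) -> \int[m]_x f x = \int[m]_(x in D) f x.
Proof.
move=> mD f0; rewrite [RHS]Rintegral_mkcond; apply: eq_Rintegral => x _.
by rewrite patchE; case: ifPn => // /negP xD; apply: f0 => Dx; apply: xD; rewrite inE.
Qed.

Lemma le_norm_Rintegral_supp f (M : R) D : measurable D -> measurable_fun setT f ->
  (forall y, `|f y| <= M) -> (forall y, ~ D y -> f y = 0) ->
  `|\int[mu]_x f x| <= M * fine (mu D).
Proof.
move=> mD mf fM f0; rewrite (Rintegral_supp _ mD f0) -(Rintegral_cst mu mD).
have fi := bounded_integrable mD mf fM.
apply: (le_trans (le_normr_Rintegral mD fi)); apply: le_Rintegral => //.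
- exact: integrable_norm.
- exact: finite_measure_integrable_cst.
Qed.

End RealIntegrals.

Lemma solve_left_inverse (R : comPzRingType) d (N G : 'I_d -> 'I_d -> R)
    (B : 'I_d -> R) j :
  (forall j k, \sum_(i < d) N j i * G i k = (j == k)%:R) ->
  B j = \sum_(i < d) N j i * \sum_(k < d) G i k * B k.
Proof.
move=> NG; rewrite (eq_bigr (fun i => \sum_(k < d) N j i * G i k * B k)); last first.
  by move=> i _; rewrite mulr_sumr; apply: eq_bigr => k _; rewrite mulrA.
rewrite exchange_big/= (eq_bigr (fun k => (j == k)%:R * B k)) => [|k _].
  rewrite (bigD1 j)//= eqxx mul1r big1 ?addr0// => k.
  by rewrite eq_sym => /negbTE ->; rewrite mul0r.
by rewrite -mulr_suml NG.
Qed.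

(** Here [G i] is the density of the i-th current with respect to [mu], and [G_div]
says that its boundary is dominated by [mu]. *)
Section Core.
Variables (R : realType) (d : nat).
Local Notation T := (borel R d).
Local Notation V := 'rV[R]_d.
Variables (mu : {finite_measure set T -> \bar R}) (W : set V).
Variable G : 'I_d -> 'I_d -> T -> R.
Hypothesis mG : forall i k, measurable_fun setT (G i k).
Hypothesis G_le : forall i k A, measurable A ->
  (\int[mu]_(x in A) `|G i k x|%:E <= mu A)%E.
Hypothesis G_div : forall i (psi : V -> R) (c : R) (x : V) (r : R),
  test_function W psi -> (forall y, `|psi y| <= c) ->
  (forall y, ~ ball x r y -> psi y = 0) ->
  `|\sum_(k < d) \int[mu]_y (partial k psi y * G i k y)| <= c * fine (mu (ball x r)).

Let a (x : V) (r : R) : R := fine (mu (ball x r)).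

Let a_ge0 x r : 0 <= a x r. Proof. by rewrite fine_ge0. Qed.

Let a_le x r s : r <= s -> a x r <= a x s.
Proof. exact: fine_measure_ball_le. Qed.

Let G_integrable i k : mu.-integrable setT (EFin \o G i k).
Proof.
apply/integrableP; split; first exact/measurable_EFinP.
by apply: le_lt_trans (G_le i k measurableT) _; rewrite ltey_eq fin_num_measure.
Qed.

Definition lebesgue_at (x : V) := forall i k (e : R), 0 < e -> exists2 r0 : R, 0 < r0 &
    forall r : R, 0 < r < r0 ->
      (\int[mu]_(y in ball x r) `|G i k y - G i k x|%:E <= e%:E * mu (ball x (10 * r)))%E.

Lemma ae_lebesgue_at : {ae mu, forall x, lebesgue_at x}.
Proof.
have : {ae mu, forall x, forall n : nat, if @unpickle ('I_d * 'I_d)%type n is Some p then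
    forall e : R, 0 < e -> exists2 r0 : R, 0 < r0 & forall r : R, 0 < r < r0 ->
      (\int[mu]_(y in ball x r) `|G p.1 p.2 y - G p.1 p.2 x|%:E <=
        e%:E * mu (ball x (10 * r)))%E else True}.
  apply: ae_foralln => n; case: (unpickle n) => [p|]; last exact: aeW.
  exact: (enlarged_lebesgue_point (mG p.1 p.2) (@G_le p.1 p.2)).
apply: (@filterS _ _ (ae_filter_ringOfSetsType mu)) => x hx i k e e0.
by have := hx (pickle (i, k)); rewrite pickleK => /(_ e e0).
Qed.

Lemma lebesgue_at_uniform x : lebesgue_at x -> forall e : R, 0 < e ->
  exists2 r0 : R, 0 < r0 & forall r : R, 0 < r < r0 -> forall i k,
      (\int[mu]_(y in ball x r) `|G i k y - G i k x|%:E <= e%:E * mu (ball x (10 * r)))%E.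
Proof.
move=> hx e e0.
have /choice[f hf] : forall p : 'I_d * 'I_d, exists r0 : R, 0 < r0 /\ forall r : R, 0 < r < r0 ->
      (\int[mu]_(y in ball x r) `|G p.1 p.2 y - G p.1 p.2 x|%:E <=
       e%:E * mu (ball x (10 * r)))%E.
  by move=> p; have [r0 r00 h] := hx p.1 p.2 e e0; exists r0.
exists (\big[Order.min/1]_p f p).
  by elim/big_ind: _ => // [u v u0 v0|p _]; [rewrite lt_min u0|have [] := hf p].
move=> r /andP[r0 rf] i k; have [_] := hf (i, k); apply; rewrite r0/=.
by apply: lt_le_trans rf _; exact: bigmin_le.
Qed.

(** Freezing the coefficients of the i-th current at x costs only the oscillation
of [G i] around x, which is small at a Lebesgue point. *)
Lemma near_constant_coefficients (x : V) (r e L c : R) (psi : V -> R) i :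
  (forall k, (\int[mu]_(y in ball x r) `|G i k y - G i k x|%:E <=
     e%:E * mu (ball x (10 * r)))%E) ->
  test_function W psi -> (forall y, `|psi y| <= c) ->
  (forall y, ~ ball x r y -> psi y = 0) ->
  (forall k y, `|partial k psi y| <= L) ->
  (forall k y, ~ ball x r y -> partial k psi y = 0) ->
  `|\sum_(k < d) G i k x * \int[mu]_y partial k psi y| <=
    c * a x r + d%:R * (L * (e * a x (10 * r))).
Proof.
move=> hG tpsi psic psi0 dpsiL dpsi0.
have mB : measurable (ball x r : set T) by exact: borel_ball.
have mdpsi k : measurable_fun setT (partial k psi : T -> R).
  by apply: borel_continuous; have [/(_ [:: k])[]] := tpsi.
have idpsi k : mu.-integrable setT (EFin \o partial k psi).
  exact: bounded_integrable (mdpsi k) (dpsiL k).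
have idG k : mu.-integrable setT (EFin \o (fun y => partial k psi y * G i k y)).
  exact: bounded_integrableM (mdpsi k) (dpsiL k) _.
have idZ k : mu.-integrable setT (EFin \o (fun y => G i k x * partial k psi y)).
  rewrite (_ : EFin \o _ =
    fun y => ((G i k x)%:E * (EFin \o partial k psi) y)%E) //.
  exact: integrableZl.
have L0 : forall k : 'I_d, 0 <= L.
  by move=> k; apply: le_trans (dpsiL k 0).
have err k : `|G i k x * \int[mu]_y partial k psi y -
    \int[mu]_y (partial k psi y * G i k y)| <= L * (e * a x (10 * r)).
  rewrite -RintegralZl// -RintegralB//.
  rewrite (@Rintegral_supp _ _ _ mu _ (ball x r)) //; last first.
    by move=> y ny; rewrite dpsi0// mulr0 mul0r subrr.
  set g := (fun y => _).
  have mg : measurable_fun setT g.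
    apply: measurable_funB; apply: measurable_funM => //.
  have ig : mu.-integrable (ball x r) (EFin \o g).
    apply: (@integrableS _ _ _ mu setT) => //.
    exact: (integrableB measurableT (idZ k) (idG k)).
  have fin10 : mu (ball x (10 * r)) \is a fin_num.
    by rewrite fin_num_measure//; exact: borel_ball.
  apply: (le_trans (le_normr_Rintegral mB ig)).
  rewrite -lee_fin fineK; last first.
    apply: integrable_fin_num => //; exact: integrable_norm.
  rewrite !EFinM /a fineK//.
  apply: (@le_trans _ _ (\int[mu]_(y in ball x r) (L%:E * `|G i k y - G i k x|%:E))%E).
    have mGx : measurable_fun setT (fun y => `|G i k y - G i k x|).
      apply: (measurableT_comp (@normr_measurable R setT)).
      exact: measurable_funB.
    apply: ge0_le_integral => //.
    - apply/measurable_EFinP; apply: measurable_funTS.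
      exact: (measurableT_comp (@normr_measurable R setT)).
    - apply: emeasurable_funM => //; apply/measurable_EFinP; exact: measurable_funTS.
    - move=> y _; rewrite -EFinM lee_fin /g [G i k x * _]mulrC -mulrBr normrM distrC.
      by rewrite ler_wpM2r.
  rewrite ge0_integralZl//; last by rewrite lee_fin (L0 k).
    by apply: lee_wpmul2l; rewrite ?lee_fin ?(L0 k)//; exact: hG.
  apply/measurable_EFinP; apply: measurable_funTS.
  apply: (measurableT_comp (@normr_measurable R setT)).
  exact: measurable_funB.
have -> : \sum_(k < d) G i k x * \int[mu]_y partial k psi y =
   \sum_(k < d) \int[mu]_y (partial k psi y * G i k y) +
   \sum_(k < d) (G i k x * \int[mu]_y partial k psi y -
     \int[mu]_y (partial k psi y * G i k y)).
  by rewrite -big_split/=; apply: eq_bigr => k _; rewrite addrC subrK.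
apply: (le_trans (ler_normD _ _)); apply: lerD; first exact: G_div.
apply: (le_trans (ler_norm_sum _ _ _)).
apply: (@le_trans _ _ (\sum_(k < d) (L * (e * a x (10 * r))))).
  by apply: ler_sum => k _; exact: err.
by rewrite sumr_const card_ord [leRHS]mulr_natl.
Qed.

Variables (x : V) (N : 'I_d -> 'I_d -> R) (rho : R).
Hypothesis NG : forall j k, \sum_(i < d) N j i * G i k x = (j == k)%:R.
Hypothesis rho0 : 0 < rho.
Hypothesis xW : ball x rho `<=` W.
Hypothesis hx : lebesgue_at x.

(** Since the matrix [G i k x] is invertible, smallness of the integrals of the
frozen combinations of derivatives gives smallness of the integral of every
partial derivative.  The derivatives are of order 1/r, so an error e in the
coefficients contributes e/r, whereas the boundary contributes a bounded term;
both are below 1/r once e and r are small. *)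
Lemma small_derivative (M : R) : 1 <= M -> exists2 r0 : R, 0 < r0 &
  forall r : R, 0 < r < r0 -> forall p : 'I_d -> R -> R,
    (forall j, smooth1 (p j)) -> (forall j t, 1 <= `|t| -> p j t = 0) ->
    (forall j t, `|p j t| <= M) -> (forall k j t, `|slot_derive k p j t| <= M) ->
    forall j, r * `|\int[mu]_y partial j (bump x r p) y| <= a x (10 * r).
Proof.
move=> M1; pose Nn := \sum_j \sum_i `|N j i|.
have Nn0 : 0 <= Nn by apply: sumr_ge0 => j _; apply: sumr_ge0.
have Md : 0 < M ^+ d by rewrite exprn_gt0// (lt_le_trans ltr01).
(* Q collects the constants; coefficients must oscillate by less than 1/(2Q) *)
pose Q := (1 + Nn) * M ^+ d * (1 + d%:R).
have Q0 : 0 < Q.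
  by rewrite !mulr_gt0// ltr_pwDl.
have e0 : 0 < (2 * Q)^-1 by rewrite invr_gt0 mulr_gt0.
have [r1 r10 hr] := lebesgue_at_uniform hx e0.
exists (Num.min (Num.min r1 (rho / 2)) (2 * Q)^-1).
  by rewrite !lt_min r10 e0 divr_gt0.
move=> r /andP[r0]; rewrite !lt_min => /andP[/andP[rr1 rrho] rQ] p sp p0 pM dpM j.
set psi := bump x r p.
have spsi : smooth psi by apply: tensor_smooth => i; exact: rescale_smooth.
have psi0 : forall y, ~ ball x r y -> psi y = 0 by exact: bump_out.
have tpsi : test_function W psi.
  apply: (test_function_supp spsi _ xW psi0); lra.
have psiM y : `|psi y| <= M ^+ d by exact: bump_le.
have dpsi0 k y : ~ ball x r y -> partial k psi y = 0.
  move=> ny; rewrite partial_bump// bump_out ?mulr0//.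
  exact: slot_derive_out.
have dpsiM k y : `|partial k psi y| <= M ^+ d / r.
  rewrite partial_bump// normrM gtr0_norm ?invr_gt0// mulrC ler_pM2r ?invr_gt0//.
  by apply: bump_le => // i t; exact: dpM.
have key i := @near_constant_coefficients x r _ _ _ psi i
  (fun k => hr r (introT andP (conj r0 rr1)) i k) tpsi psiM psi0 dpsiM dpsi0.
have -> : \int[mu]_y partial j psi y =
    \sum_(i < d) N j i * \sum_(k < d) G i k x * \int[mu]_y partial k psi y.
  exact: (@solve_left_inverse R d N (fun i k => G i k x)
    (fun k => \int[mu]_y partial k psi y) j NG).
pose b := M ^+ d * a x r + d%:R * (M ^+ d / r * ((2 * Q)^-1 * a x (10 * r))).
have b0 : 0 <= b.
  apply: addr_ge0; first exact: mulr_ge0 (ltW Md) _.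
  apply: mulr_ge0 => //; apply: mulr_ge0; first exact: divr_ge0 (ltW Md) (ltW r0).
  exact: mulr_ge0 (ltW e0) _.
apply: (@le_trans _ _ (r * ((1 + Nn) * b))).
  rewrite ler_wpM2l ?(ltW r0)//.
  apply: (@le_trans _ _ (Nn * b)); last by rewrite ler_wpM2r// lerDr.
  apply: (le_trans (ler_norm_sum _ _ _)).
  apply: (@le_trans _ _ (\sum_i `|N j i| * b)).
    by apply: ler_sum => i _; rewrite normrM ler_wpM2l.
  rewrite -mulr_suml ler_wpM2r// /Nn [leRHS](bigD1 j)//= lerDl.
  by apply: sumr_ge0 => i _; apply: sumr_ge0.
have -> : r * ((1 + Nn) * b) = (1 + Nn) * M ^+ d *
    (r * a x r + d%:R * (2 * Q)^-1 * a x (10 * r)).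
  by rewrite /b; field; rewrite !gt_eqF.
apply: (@le_trans _ _ ((1 + Nn) * M ^+ d * ((1 + d%:R) * (2 * Q)^-1 * a x (10 * r)))).
  rewrite ler_wpM2l ?mulr_ge0 ?addr_ge0 ?(ltW Md)//.
  rewrite [leRHS](_ : _ = (2 * Q)^-1 * a x (10 * r) +
    d%:R * (2 * Q)^-1 * a x (10 * r)); last by ring.
  rewrite lerD2r; apply: ler_pM => //; [exact: ltW|exact: ltW|].
  by apply: a_le; rewrite ler_peMl ?(ltW r0)// ler1n.
rewrite [leLHS](_ : _ = 2^-1 * a x (10 * r)).
  by have := a_ge0 x (10 * r); lra.
rewrite /Q; field; rewrite ?(gt_eqF Md)//.
have ->: 1 + Nn != 0 by rewrite gt_eqF// ltr_pwDl.
by have -> : 1 + d%:R != 0 :> R by rewrite gt_eqF// ltr_pwDl.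
Qed.

(** The constants [K] and [delta] come from the profile b alone, whereas [r0]
may depend on [lam].  This order of quantifiers is what makes [power_decay] work. *)
Lemma decay_step : exists K delta : R, [/\ 0 < K, 0 < delta & forall lam : R, 1 <= lam ->
  exists2 r0 : R, 0 < r0 & forall r : R, 0 < r < r0 ->
    lam ^+ d * a x (delta / lam * r) <= K * a x (10 * r)].
Proof.
have [c [delta [c0 delta0 hc]]] := @smooth_step'_lower R.
have sb := @smooth_step'_smooth R.
have [Cb Cb1 hCb] :=
  bounded_continuous_supp (smooth1_continuous sb) (@smooth_step'_out R).
have cd : 0 < c ^+ d by rewrite exprn_gt0.
have Cbd : 0 < Cb ^+ d by rewrite exprn_gt0// (lt_le_trans ltr01).
exists ((Cb ^+ d + d%:R) / c ^+ d), delta; split => //.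
  by rewrite divr_gt0// ltr_pwDl.
move=> lam lam1; have lam0 : 0 < lam by rewrite (lt_le_trans ltr01).
have [M M1 [pM dpM]] := @dilation_profile_bounded R d lam lam1.
have [r0 r00 hr] := small_derivative M1.
exists r0 => // r rr; have r_gt0 : 0 < r by case/andP: rr.
pose phil := bump x r (fun=> fun t => smooth_step' (lam * t + 0)).
pose phi1 := bump x r (fun=> @smooth_step' R).
pose dpsi j := partial j (bump x r (dilation_profile lam j)).
have mB s : measurable (ball x s : set T) by exact: borel_ball.
have mphil : measurable_fun setT (phil : T -> R).
  apply: borel_continuous; apply: tensor_continuous; apply: rescale_smooth => j n.
  exact: (times_derivable_aff lam 0 (sb n)).
have mphi1 : measurable_fun setT (phi1 : T -> R).
  by apply: borel_continuous; apply: tensor_continuous; exact: rescale_smooth.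
have phil_le y : `|phil y| <= Cb ^+ d by apply: bump_le => // ? t.
have phi1_le y : `|phi1 y| <= Cb ^+ d by exact: bump_le.
have iphil D : measurable D -> mu.-integrable D (EFin \o phil).
  by move=> mD; exact: bounded_integrable mD mphil phil_le.
have iphi1 : mu.-integrable setT (EFin \o phi1).
  exact: bounded_integrable measurableT mphi1 phi1_le.
have phil_ge0 y : 0 <= phil y.
  by rewrite /phil bumpE; apply: prodr_ge0 => j _; exact: smooth_step'_ge0.
have idpsi j : mu.-integrable setT (EFin \o dpsi j).
  have sp := @dilation_profile_smooth R d lam j.
  rewrite /dpsi partial_bump//; apply: (@bounded_integrable _ _ _ _ _ (r^-1 * M ^+ d)) => //.
    apply: measurable_funM => //; apply: borel_continuous.
    by apply: tensor_continuous; apply: rescale_smooth; exact: slot_derive_smooth.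
  move=> y; rewrite normrM gtr0_norm ?invr_gt0// ler_pM2l ?invr_gt0//.
  by apply: bump_le => // i t; exact: dpM.
have small j : r * `|\int[mu]_y dpsi j y| <= a x (10 * r).
  apply: hr => // [i|i t t1].
    exact: dilation_profile_smooth.
  exact: dilation_profile_out.
have ident : lam ^+ d * \int[mu]_y phil y =
    \int[mu]_y phi1 y + r * \sum_(j < d) \int[mu]_y dpsi j y.
  rewrite -(RintegralZl _ measurableT (iphil _ measurableT)).
  rewrite -Rintegral_sum// -RintegralZl//; last first.
    rewrite (_ : EFin \o _ = fun y => (\sum_(j < d) (EFin \o dpsi j) y)%E); last first.
      by apply/funext => y; rewrite /= sumEFin.
    exact: integrable_sum.
  rewrite -RintegralD//; last first.
    rewrite (_ : EFin \o _ = fun y => (r%:E * \sum_(j < d) (EFin \o dpsi j) y)%E); last first.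
      by apply/funext => y; rewrite /= sumEFin EFinM.
    by apply: integrableZl => //; exact: integrable_sum.
  apply: eq_Rintegral => y _.
  by rewrite -(dilation_identity lam x y r_gt0) addrC subrK.
have lower : c ^+ d * a x (delta / lam * r) <= \int[mu]_y phil y.
  rewrite /a -(Rintegral_cst mu (mB _)).
  apply: (@le_trans _ _ (\int[mu]_(y in ball x (delta / lam * r)) phil y)).
    apply: le_Rintegral => //.
    - exact: finite_measure_integrable_cst.
    - exact: iphil.
    have dr0 : 0 < delta / lam * r by rewrite mulr_gt0// divr_gt0.
    move=> y /(rV_ballP _ _ dr0) hy.
    rewrite /phil bumpE -[X in c ^+ X](card_ord d) -prodr_const.
    apply: ler_prod => j _; rewrite (ltW c0)/= hc// addr0 !normrM.
    rewrite (gtr0_norm lam0) gtr0_norm ?invr_gt0//.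
    have -> : delta = lam * (r^-1 * (delta / lam * r)).
      by field; rewrite !gt_eqF.
    by rewrite !ltr_pM2l ?invr_gt0.
  rewrite /Rintegral; apply: fine_le.
  - by apply: integrable_fin_num => //; exact: iphil.
  - by apply: integrable_fin_num => //; exact: iphil.
  - apply: ge0_subset_integral => //; first by apply/measurable_EFinP.
    by move=> y _; rewrite lee_fin.
have upper : \int[mu]_y phi1 y <= Cb ^+ d * a x (10 * r).
  apply: (le_trans (ler_norm _)).
  apply: (@le_trans _ _ (Cb ^+ d * a x r)).
    apply: le_norm_Rintegral_supp => //.
    by apply: bump_out => // j; exact: smooth_step'_out.
  by rewrite ler_pM2l// a_le// ler_peMl ?(ltW r_gt0)// ler1n.
rewrite [leRHS]mulrAC ler_pdivlMr//.
rewrite [leLHS](_ : _ = lam ^+ d * (c ^+ d * a x (delta / lam * r))); last by ring.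
apply: (@le_trans _ _ (lam ^+ d * \int[mu]_y phil y)).
  by rewrite ler_wpM2l// exprn_ge0// ltW.
rewrite ident mulrDl lerD// mulr_sumr.
apply: (@le_trans _ _ (\sum_(j < d) a x (10 * r))).
  apply: ler_sum => j _; apply: le_trans (small j).
  by rewrite ler_wpM2l ?(ltW r_gt0)// ler_norm.
by rewrite sumr_const card_ord [leRHS]mulr_natl.
Qed.

End Core.

(** * Decay of the measure of balls and Hausdorff null sets *)

Section PowerDecay.
Variable R : realType.

(** One step multiplies the radius by rho = delta / (10 lam) and [a] by
K / lam^d.  As kappa < d, this is at most rho^kappa for lam large, whatever the
constants; iterating the step gives the power law. *)
Lemma power_decay (a : R -> R) (d : nat) (kappa K delta : R) :
  (forall r, 0 <= a r) -> (forall r s, r <= s -> a r <= a s) ->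
  0 < K -> 0 < delta -> 0 <= kappa < d%:R ->
  (forall lam : R, 1 <= lam -> exists2 r0 : R, 0 < r0 & forall r : R, 0 < r < r0 ->
    lam ^+ d * a (delta / lam * r) <= K * a (10 * r)) ->
  exists C r0 : R, 0 < r0 /\ forall r : R, 0 < r < r0 -> a r <= C * r `^ kappa.
Proof.
move=> a0 a_le K0 delta0 /andP[k0 kd] step.
pose A := (delta / 10) `^ kappa.
have A0 : 0 < A by rewrite powR_gt0// divr_gt0.
have dk : 0 < d%:R - kappa by rewrite subr_gt0.
pose lam := 1 + delta + (K / A) `^ (d%:R - kappa)^-1.
have Z0 : 0 <= (K / A) `^ (d%:R - kappa)^-1 by exact: powR_ge0.
have lam1 : 1 <= lam by rewrite /lam -addrA lerDl addr_ge0// ltW.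
have lam0 : 0 < lam by rewrite (lt_le_trans ltr01).
have lamZ : K <= A * lam `^ (d%:R - kappa).
  rewrite -ler_pdivrMl// mulrC.
  have KA : 0 <= K / A by rewrite divr_ge0// ltW.
  have -> : K / A = ((K / A) `^ (d%:R - kappa)^-1) `^ (d%:R - kappa).
    by rewrite -powRrM mulVf ?powRr1// gt_eqF.
  apply: ge0_ler_powR; [exact: ltW|exact: Z0|exact: ltW|].
  by rewrite /lam lerDr addr_ge0// ltW.
pose rho := delta / lam / 10.
have rho0 : 0 < rho by rewrite !divr_gt0.
have rho1 : rho < 1.
  rewrite /rho ltr_pdivrMr// ltr_pdivrMr// mul1r.
  apply: (@lt_le_trans _ _ lam); last by rewrite ler_peMl ?(ltW lam0)// ler1n.
  by rewrite /lam; apply: (@lt_le_trans _ _ (1 + delta)); rewrite ?ltrDr// lerDl.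
have [r0 r00 hr] := step lam lam1.
have Krho : K <= rho `^ kappa * lam ^+ d.
  rewrite (le_trans lamZ)// -powR_mulrn ?(ltW lam0)//.
  have -> : d%:R = kappa + (d%:R - kappa) by rewrite addrC subrK.
  rewrite powRD; last by rewrite (gt_eqF lam0) implybT.
  rewrite mulrA -powRM ?(ltW rho0) ?(ltW lam0)// /rho.
  rewrite (_ : delta / lam / 10 * lam = delta / 10) 1?[kappa + _]addrC ?addrK//.
  by field; rewrite gt_eqF.
have contr s : 0 < s < 10 * r0 -> a (rho * s) <= rho `^ kappa * a s.
  move=> /andP[s0 sr].
  have := hr (s / 10); rewrite divr_gt0// ltr_pdivrMr// mulrC sr => /(_ isT).
  rewrite (_ : delta / lam * (s / 10) = rho * s); last by rewrite /rho; ring.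
  rewrite (_ : 10 * (s / 10) = s); last by field.
  move=> h; rewrite -(ler_pM2l (exprn_gt0 d lam0)); apply: (le_trans h).
  by rewrite mulrCA mulrA ler_wpM2r// mulrC.
clearbody rho.
pose s0 := 5 * r0.
have s00 : 0 < s0 by rewrite mulr_gt0.
have rho_le1 n : rho ^+ n <= 1 by rewrite exprn_ile1// ltW.
have iter n : a (rho ^+ n * s0) <= (rho `^ kappa) ^+ n * a s0.
  elim: n => [|n IHn]; first by rewrite !expr0 !mul1r.
  rewrite !exprS -!mulrA; apply: (@le_trans _ _ (rho `^ kappa * a (rho ^+ n * s0))).
    apply: contr; rewrite mulr_gt0 ?exprn_gt0//=.
    apply: (@le_lt_trans _ _ s0); first by rewrite ler_piMl// ltW.
    by rewrite ltr_pM2r// ltr_nat.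
  by rewrite ler_wpM2l// powR_ge0.
have c0 : 0 < s0 `^ kappa * rho `^ kappa by rewrite mulr_gt0// powR_gt0.
exists (a s0 / (s0 `^ kappa * rho `^ kappa)), s0; split => // r /andP[r_gt0 rs].
have ex : exists n, rho ^+ n * s0 <= r.
  have rho_norm : `|rho| < 1 by rewrite ger0_norm// ltW.
  have /cvgrPdist_lt/(_ (r / s0)) := cvg_expr rho_norm.
  rewrite divr_gt0// => /(_ isT)[n _ /(_ n (leqnn n))].
  rewrite sub0r normrN /= ger0_norm ?exprn_ge0 ?(ltW rho0)// ltr_pdivlMr// => h.
  by exists n; exact: ltW.
(* compare r with the first radius rho^m s0 below it *)
have [m hm hmin] := ex_minnP ex.
case: m hm hmin => [|m] hm hmin; first by move: hm; rewrite expr0 mul1r leNgt rs.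
have rm : r <= rho ^+ m * s0.
  rewrite leNgt; apply/negP => h.
  by have := hmin m (ltW h); rewrite ltnn.
apply: (le_trans (a_le _ _ rm)); apply: (le_trans (iter m)).
have h : (rho `^ kappa) ^+ m * (s0 `^ kappa * rho `^ kappa) <= r `^ kappa.
  rewrite mulrCA -exprSr -powR_mulrn ?powR_ge0// powRAC powR_mulrn ?(ltW rho0)//.
  rewrite -powRM ?exprn_ge0 ?(ltW rho0) ?(ltW s00)//.
  apply: ge0_ler_powR => //; rewrite ?nnegrE ?(ltW r_gt0)//; last by rewrite mulrC.
  by apply: mulr_ge0; [exact: ltW|rewrite exprn_ge0// ltW].
by rewrite mulrC -[leRHS]mulrA ler_wpM2l// [leRHS]mulrC ler_pdivlMr.
Qed.

End PowerDecay.

Section HausdorffNull.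
Variables (R : realType) (d : nat).
Local Notation T := (borel R d).
Local Notation V := 'rV[R]_d.

Lemma coord_le_enorm n (v : 'rV[R]_n) j : `|v ord0 j| <= enorm v.
Proof.
rewrite -sqrtr_sqr /enorm ler_sqrt; last by apply: sumr_ge0 => i _; exact: sqr_ge0.
by rewrite (bigD1 j)//= lerDl; apply: sumr_ge0 => i _; exact: sqr_ge0.
Qed.

Lemma norm_le_enorm (v : V) : `|v| <= enorm v.
Proof.
rewrite [leLHS]/Num.norm/= mx_normrE; apply: bigmax_le => [|[i j] _ /=].
  exact: sqrtr_ge0.
by rewrite ord1 coord_le_enorm.
Qed.

Lemma enorm_le_ediam (U : set V) (x y : V) : U x -> U y ->
  ((enorm (x - y))%:E <= ediam U)%E.
Proof. by move=> Ux Uy; apply: ereal_sup_ubound; exists (x, y). Qed.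

Lemma closed_ball_measurable (x : V) (D : R) :
  measurable ([set y : V | (`|x - y| <= D)%R] : set T).
Proof. by apply: borel_closed; exact: closed_closed_ball_. Qed.

Variable mu : {finite_measure set T -> \bar R}.

(** Closed balls are needed because the sets of a Hausdorff cover may be single
points, and the sets of diameter zero enter the sum with weight 0 when kappa > 0. *)
Lemma closed_ball_decay (x : V) (C kappa r0 D : R) : 0 <= C -> 0 <= kappa -> 0 <= D ->
  2 * D < r0 ->
  (forall r, 0 < r < r0 -> fine (mu (ball x r)) <= C * r `^ kappa) ->
  (mu [set y : V | (`|x - y| <= D)%R] <= (C * 2 `^ kappa * D `^ kappa)%:E)%E.
Proof.
move=> C0 k0 D0 Dr hC.
have mD := closed_ball_measurable x D.
have ball_bound r : D < r < r0 ->
    (mu [set y : V | (`|x - y| <= D)%R] <= (C * r `^ kappa)%:E)%E.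
  move=> /andP[Dr1 rr0].
  apply: (@le_trans _ _ (mu (ball x r))).
    apply: le_measure; rewrite ?inE//; first exact: borel_ball.
    by move=> y /= h; rewrite -ball_normE /ball_/=; exact: le_lt_trans Dr1.
  rewrite -(fineK (fin_num_measure mu _ (borel_ball x r))) lee_fin; apply: hC.
  by rewrite rr0 (le_lt_trans D0).
move: D0; rewrite le_eqVlt => /orP[/eqP D0|D0]; last first.
  rewrite -mulrA -powRM ?(ltW D0)//; apply: ball_bound; rewrite Dr.
  by rewrite ltr_pMl// ltr1n.
have r00 : 0 < r0 by move: Dr; rewrite -D0 mulr0.
have [kap0|kap_neq0] := eqVneq kappa 0.
  have := ball_bound (r0 / 2); rewrite -D0 kap0 !powRr0 !mulr1; apply.
  by rewrite divr_gt0//= ltr_pdivrMr// ltr_pMr// ltr1n.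
have kap_gt0 : 0 < kappa by rewrite lt_def kap_neq0.
rewrite -[in leRHS]D0 powR0// mulr0; apply/lee_addgt0Pr => e e0.
have Ce : 0 < e / (C + 1) by rewrite divr_gt0// ltr_wpDl.
pose r := Num.min (r0 / 2) ((e / (C + 1)) `^ kappa^-1).
have r_gt0 : 0 < r by rewrite lt_min divr_gt0//= powR_gt0.
have rr0 : r < r0.
  rewrite gt_min; apply/orP; left.
  by rewrite ltr_pdivrMr// ltr_pMr// ltr1n.
have Drr : D < r < r0 by rewrite -D0 r_gt0.
rewrite -D0 in ball_bound Drr *; apply: (le_trans (ball_bound _ Drr)).
rewrite add0e lee_fin.
apply: (@le_trans _ _ (C * (e / (C + 1)))); last first.
  by rewrite mulrCA ger_pMr// ler_pdivrMr ?mul1r ?lerDl// ltr_wpDl.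
rewrite ler_wpM2l//.
have -> : e / (C + 1) = ((e / (C + 1)) `^ kappa^-1) `^ kappa.
  by rewrite -powRrM mulVf ?powRr1// ltW.
apply: ge0_ler_powR => //; rewrite ?nnegrE ?(ltW r_gt0) ?powR_ge0//.
by rewrite /r ge_min lexx orbT.
Qed.

(** The decay bounds mu by kappa-th powers of diameters, hence by the sums that
define the Hausdorff measure: each set of the cover that meets [S] lies in a closed ball centred in [S]
whose radius is the diameter of the set. *)
Lemma uniform_decay_negligible (A S : set V) (C kappa r0 : R) :
  0 <= kappa -> 0 < r0 -> 0 <= C ->
  (hausdorff kappa (A : set T) = 0)%E -> S `<=` A ->
  (forall x, S x -> forall r, 0 < r < r0 -> fine (mu (ball x r)) <= C * r `^ kappa) ->
  mu.-negligible (S : set T).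
Proof.
move=> k0 r00 C0 hA SA hC; apply: negligible_small_cover => e e0.
pose C' := C * 2 `^ kappa.
have C'0 : 0 <= C' by rewrite mulr_ge0// powR_ge0.
have e'0 : 0 < e / (C' + 1) by rewrite divr_gt0// ltr_wpDl.
pose delta := r0 / 4.
have delta0 : 0 < delta by rewrite divr_gt0.
have : (hausdorff_delta kappa delta A < (e / (C' + 1))%:E)%E.
  apply: (@le_lt_trans _ _ 0%E); last by rewrite lte_fin.
  by rewrite -hA; apply: ereal_sup_ubound; exists delta.
move=> /ereal_inf_lt[_ [U [AU Udelta] <-] sumU].
have /choice[f hf] : forall k, exists x : V, S `&` U k !=set0 -> (S `&` U k) x.
  move=> k; have [[x Sx]|nS] := pselect (S `&` U k !=set0); first by exists x.
  by exists 0 => /nS.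
pose D k := fine (ediam (U k)).
pose B k : set T := if `[< S `&` U k !=set0 >] then
  [set y : V | (`|f k - y| <= D k)%R] else set0.
have Dfin k : S `&` U k !=set0 -> [/\ ediam (U k) = (D k)%:E, 0 <= D k & D k <= delta].
  move=> [x [_ Ux]].
  have e1 : (0 <= ediam (U k))%E.
    by apply: le_trans (enorm_le_ediam Ux Ux); rewrite lee_fin sqrtr_ge0.
  have e2 := Udelta k.
  have efin : ediam (U k) \is a fin_num by rewrite ge0_fin_numE// (le_lt_trans e2) ?ltry.
  by split; rewrite ?fineK// ?fine_ge0// -lee_fin fineK.
have mB k : measurable (B k).
  by rewrite /B; case: ifP => _; [exact: closed_ball_measurable|exact: measurable0].
exists (\bigcup_k B k); split; first exact: bigcupT_measurable.
  move=> x Sx; have [k _ Ukx] := AU x (SA x Sx); exists k => //.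
  have ne : S `&` U k !=set0 by exists x.
  rewrite /B (asboolT ne)/= -lee_fin; have [<- _ _] := Dfin k ne.
  apply: le_trans (enorm_le_ediam (hf k ne).2 Ukx).
  by rewrite lee_fin norm_le_enorm.
have diam_ge0 k : (0 <= diam_pow kappa (U k))%E.
  by rewrite /diam_pow; case: ifP => // _; exact: poweR_ge0.
apply: (@le_trans _ _ (\sum_(k <oo) mu (B k)))%E.
  by apply: measure_sigma_subadditive => //; exact: bigcupT_measurable.
apply: (@le_trans _ _ (\sum_(k <oo) C'%:E * diam_pow kappa (U k)))%E.
  apply: lee_nneseries => // k _; rewrite /B; case: asboolP => [ne|_]; last first.
    by rewrite measure0 mule_ge0.
  have [dE D0 Dd] := Dfin k ne; have [Afk Ufk] := hf k ne.
  have -> : diam_pow kappa (U k) = (D k `^ kappa)%:E.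
    rewrite /diam_pow dE poweR_EFin ifF//; apply/negbTE/set0P; by exists (f k).
  rewrite -EFinM; apply: (closed_ball_decay C0 k0 D0 _ (hC _ Afk)).
  by apply: (@le_lt_trans _ _ (2 * delta)); rewrite ?ler_pM2l// /delta; lra.
rewrite nneseriesZl//; apply: (@le_trans _ _ (C'%:E * (e / (C' + 1))%:E)%E).
  by apply: lee_wpmul2l => //; exact: ltW.
rewrite -EFinM lee_fin mulrCA ger_pMr// ler_pdivrMr ?mul1r ?lerDl//.
by rewrite ltr_wpDl.
Qed.

Lemma decay_negligible (A G : set V) (kappa : R) : 0 <= kappa ->
  (hausdorff kappa (A : set T) = 0)%E -> G `<=` A ->
  (forall x, G x -> exists C r0 : R, 0 < r0 /\
    forall r, 0 < r < r0 -> fine (mu (ball x r)) <= C * r `^ kappa) ->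
  mu.-negligible (G : set T).
Proof.
move=> k0 hA GA hC.
pose S n : set V := [set x | G x /\ forall r, 0 < r < n.+1%:R^-1 ->
  fine (mu (ball x r)) <= n%:R * r `^ kappa].
have neg : mu.-negligible (\bigcup_n (S n : set T)).
  apply: negligible_bigcup => n.
  apply: (@uniform_decay_negligible A (S n) n%:R kappa n.+1%:R^-1) => //.
  - by move=> x [/GA].
  - by move=> x [].
apply: negligibleS neg => x Gx; have [C [r0 [r00 hr]]] := hC x Gx.
have [n _ hn] := near_infty_natSinv_lt (PosNum r00).
pose m := maxn n (Num.truncn `|C|).+1.
exists m => //; split => // r /andP[r_gt0 rm].
apply: (@le_trans _ _ (C * r `^ kappa)).
  apply: hr; rewrite r_gt0/=; apply: lt_trans rm _.
  by have /= := hn m (leq_maxl _ _).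
rewrite ler_wpM2r ?powR_ge0// (le_trans (ler_norm _))//.
rewrite (le_trans (ltW (truncnS_gt _)))// ler_nat.
exact: leq_maxr.
Qed.

End HausdorffNull.

(** * Densities of currents and boundaries *)

Section RealDensity.
Context d (T : measurableType d) (R : realType).
Local Open Scope ereal_scope.

Lemma real_density (nu mu : {finite_measure set T -> \bar R}) :
  (forall A, measurable A -> nu A <= mu A) ->
  exists rho : T -> R, [/\ measurable_fun setT rho, (forall x, 0 <= rho x)%R,
    (forall A, measurable A -> nu A = \int[mu]_(x in A) (rho x)%:E),
    (forall (f : T -> R) A, measurable A -> measurable_fun setT f ->
       \int[mu]_(x in A) `|f x * rho x|%:E = \int[nu]_(x in A) `|f x|%:E) &
    (forall f : T -> R, nu.-integrable setT (EFin \o f) ->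
       (\int[mu]_x (f x * rho x) = \int[nu]_x f x)%R)].
Proof.
move=> numu.
have dom : nu `<< mu.
  apply/null_content_dominatesP => A mA A0.
  by apply/eqP; rewrite -measure_le0 -A0; exact: numu.
pose g := Radon_Nikodym_SigmaFinite.f nu mu.
have gfin x : g x \is a fin_num by exact: Radon_Nikodym_SigmaFinite.f_fin_num.
have g0 x : 0 <= g x by exact: Radon_Nikodym_SigmaFinite.f_ge0.
have ig : mu.-integrable setT g by exact: Radon_Nikodym_SigmaFinite.f_integrable.
have mg : measurable_fun setT g by exact: measurable_int ig.
have gE x : (fine (g x))%:E = g x by rewrite fineK.
exists (fine \o g); split.
- exact: measurableT_comp mg.
- by move=> x; exact: fine_ge0.
- move=> A mA; rewrite (Radon_Nikodym_SigmaFinite.f_integral dom mA).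
  by apply: eq_integral => x _; rewrite /= gE.
- move=> f A mA mf.
  have mfA : measurable_fun A (fun x => `|f x|%:E).
    by apply/measurable_EFinP; apply: measurable_funTS; exact: measurableT_comp.
  have := Radon_Nikodym_SigmaFinite.change_of_variables dom (f := fun x => `|f x|%:E)
    _ mA mfA => <-; last by move=> x; rewrite lee_fin.
  apply: eq_integral => x _; rewrite /= normrM EFinM; congr (_ * _).
  by rewrite ger0_norm ?gE// fine_ge0.
- move=> f intf; rewrite /Rintegral; congr fine.
  have mf : measurable_fun setT (EFin \o f) by exact: measurable_int intf.
  rewrite -[RHS](Radon_Nikodym_change_of_variables dom measurableT intf).
  transitivity (\int[mu]_x ((EFin \o f) x * g x)).
    by apply: eq_integral => x _; rewrite /= EFinM gE.
  apply: ae_eq_integral => //.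
  + exact: emeasurable_funM.
  + by apply: emeasurable_funM => //; apply: measurable_int; exact: Radon_Nikodym_integrable.
  + exact/ae_eqe_mul2l/ae_eq_Radon_Nikodym_SigmaFinite.
Qed.

End RealDensity.

Section Polar.
Variables (R : realType) (d : nat) (Omega : set 'rV[R]_d) (n : nat).
Variables (S : radon_measure Omega n) (P : polar_decomposition S).
Local Notation T := (borel R d).

Lemma polar_dir_le1 : {ae polar_tv P, forall x, forall j, `|polar_dir P x ord0 j| <= 1}.
Proof.
apply: (@filterS _ _ (ae_filter_ringOfSetsType (polar_tv P))) (polar_dir_unit P).
by move=> x <- j; exact: coord_le_enorm.
Qed.

End Polar.

Section Boundary.
Variables (R : realType) (d : nat) (Omega : set 'rV[R]_d).
Variables (S : radon_measure Omega d) (P : polar_decomposition S).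
Local Notation T := (borel R d).
Local Notation V := 'rV[R]_d.

(** The total variation of the boundary serves as q.  Only the norm of the test
function enters, not that of its derivatives: this gain is what makes the
currents rigid at small scales. *)
Lemma normal_boundary_le : normal_current P ->
  exists q : {measure set T -> \bar R}, positive_radon Omega q /\
    forall (phi : V -> R) (c : R) (B : set V), test_function Omega phi ->
      measurable (B : set T) -> (q B < +oo)%E -> (forall y, `|phi y| <= c) ->
      (forall y, ~ B y -> phi y = 0) -> `|boundary P phi| <= c * fine (q B).
Proof.
move=> [nu [Q hQ]]; exists (polar_tv Q); split; first exact: polar_tv_radon.
move=> phi c B tphi mB finB phic phi0; rewrite (hQ phi tphi) /pairing.
set q := polar_tv Q in finB *.
set F := fun x => edot _ _.
have FE x : F x = phi x * polar_dir Q x ord0 ord0 by rewrite /F /edot big_ord1 mxE.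
have c0 : 0 <= c by exact: le_trans (phic 0).
have mphi : measurable_fun setT (phi : T -> R).
  by apply: borel_continuous; have [/(_ [::])[]] := tphi.
have mF : measurable_fun setT (F : T -> R).
  rewrite (_ : F = fun x => phi x * polar_dir Q x ord0 ord0); last exact/funext.
  by apply: measurable_funM => //; exact: polar_dir_measurable.
rewrite (@Rintegral_supp _ T R q F B mB); last first.
  by move=> y ny; rewrite FE phi0// mul0r.
have mFB : measurable_fun (B : set T) (EFin \o F).
  by apply/measurable_EFinP; exact: measurable_funTS.
have bound : (`|\int[q]_(x in B) (F x)%:E| <= c%:E * q B)%E.
  apply: (le_trans (le_abse_integral q mB mFB)).
  rewrite -(integral_cst q mB); apply: ae_ge0_le_integral => //.
  - exact: measurableT_comp.
  - apply: (@filterS _ _ (ae_filter_ringOfSetsType q)) (polar_dir_le1 Q).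
    move=> x hx _; rewrite /= lee_fin FE normrM -[leRHS]mulr1.
    by apply: ler_pM.
have finqB : q B \is a fin_num by rewrite ge0_fin_numE.
have cfin : (c%:E * q B)%E \is a fin_num by rewrite fin_numM.
have Ifin : (\int[q]_(x in B) (F x)%:E)%E \is a fin_num.
  by rewrite -abse_fin_num ge0_fin_numE// (le_lt_trans bound)// ltey_eq cfin.
rewrite /Rintegral -fine_abse// (_ : c = fine c%:E)// -fineM//.
by apply: fine_le; rewrite // abse_fin_num.
Qed.

End Boundary.

(** * Dimension of sigma *)

Section TestFunctions.
Variables (R : realType) (d : nat) (W : set 'rV[R]_d).

Lemma partial_out (psi : 'rV[R]_d -> R) k y :
  ~ closure [set x | psi x != 0] y -> partial k psi y = 0.
Proof.
move=> ny; rewrite /partial (@near_eq_derive _ _ _ psi (cst 0)) ?derive_cst//.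
have : nbhs y (~` closure [set x | psi x != 0]).
  by apply: open_nbhs_nbhs; split => //; exact/closed_openC/closed_closure.
apply: filterS => x nx; apply/eqP/negPn/negP => px; apply: nx.
exact: subset_closure.
Qed.

Lemma partial_bounded (psi : 'rV[R]_d -> R) k : test_function W psi ->
  exists M : R, forall y, `|partial k psi y| <= M.
Proof.
move=> [spsi cK _]; have [cd _] := spsi [:: k].
have cimg : compact (partial k psi @` closure [set x | psi x != 0]).
  by apply: continuous_compact => //; exact: continuous_subspaceT.
have [M [_ hM]] := compact_bounded cimg.
exists (Num.max 0 (M + 1)) => y.
have [Ky|nKy] := pselect (closure [set x | psi x != 0] y); last first.
  by rewrite partial_out// normr0 le_max lexx.
rewrite le_max; apply/orP; right.
by apply: (hM (M + 1)); [rewrite ltrDl|exists y].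
Qed.

End TestFunctions.

Lemma span_unitmx (F : fieldType) d (v : 'I_d -> 'rV[F]_d) :
  <<[seq v i | i <- enum 'I_d]>>%VS = fullv ->
  (\matrix_(i, k) v i ord0 k) \in unitmx.
Proof.
move=> vfull; rewrite -unitmx_tr -row_free_unit; apply: inj_row_free => u u0.
have ker (w : 'rV[F]_d) : w *m u^T = 0.
  suff : w \in lker (linfun (mulmxr u^T : 'rV[F]_d -> 'rV[F]_1)).
    by rewrite memv_ker lfunE => /eqP.
  have : w \in <<[seq v i | i <- enum 'I_d]>>%VS by rewrite vfull memvf.
  apply: subvP; apply/span_subvP => _ /mapP[i _ ->].
  rewrite memv_ker lfunE /=; apply/eqP/matrixP => a b; rewrite !ord1 !mxE.
  have /matrixP/(_ ord0 i) := u0; rewrite !mxE => h; rewrite -[RHS]h.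
  by apply: eq_bigr => k _; rewrite !mxE mulrC.
apply/matrixP => a k; rewrite ord1 mxE.
have /matrixP/(_ ord0 ord0) := ker (delta_mx ord0 k); rewrite !mxE => h; rewrite -[RHS]h.
rewrite (bigD1 k)//= !mxE !eqxx mul1r big1 ?addr0// => j /negbTE jk.
by rewrite !mxE jk andbF mul0r.
Qed.

Section Local.
Variables (R : realType) (d : nat) (Omega : set 'rV[R]_d).
Local Notation T := (borel R d).
Local Notation V := 'rV[R]_d.
Variables (S : 'I_d -> radon_measure Omega d).
Variable P : forall i, polar_decomposition (S i).
Variable sigma : {measure set T -> \bar R}.
Hypothesis normalP : forall i, normal_current (P i).
Hypothesis sigma_tv : forall i, sigma `<< polar_tv (P i).
Hypothesis span_dir : {ae sigma, forall x : T,
   <<[seq polar_dir (P i) x | i <- enum 'I_d]>>%VS = fullv}.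

(** Everything is restricted to the compact set [K], on which all the measures
are finite.  A point of [A] in [W] either has the decay of [power_decay], or fails
to be a Lebesgue point of the densities, or is a point where the directions do
not span or where one of the densities of the ||T_i|| vanishes.  The first kind is
controlled by [decay_negligible], the second is mu-null, and the others are
sigma-null by the two assumptions on sigma. *)
Lemma local_null (K W : set V) (A : set T) (kappa : R) :
  compact K -> K `<=` Omega -> open W -> W `<=` K -> 0 <= kappa < d%:R ->
  hausdorff kappa A = 0%E -> sigma.-negligible (A `&` W : set T).
Proof.
move=> cK KO oW WK /andP[k0 kd] hA.
have mK : measurable (K : set T).
  by apply: borel_closed; exact: compact_closed.
have tvfin i : (polar_tv (P i) K < +oo)%E by have [_] := polar_tv_radon (P i); exact.
pose m i : {finite_measure set T -> \bar R} := mfrestr mK (tvfin i).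
have mE i B : m i B = polar_tv (P i) (B `&` K) by [].
have /choice[q hq] := fun i => normal_boundary_le (normalP i).
have qfin i : (q i K < +oo)%E by have [[_ h] _] := hq i; exact: h.
pose n i : {finite_measure set T -> \bar R} := mfrestr mK (qfin i).
have nE i B : n i B = q i (B `&` K) by [].
have [mu1 hmu1] := exists_dominating_measure m.
have [mu2 hmu2] := exists_dominating_measure n.
have [mu hmu] := exists_dominating_measure
  (fun i : 'I_2 => if i == ord0 then mu1 else mu2).
have m_mu i B : measurable B -> (m i B <= mu B)%E.
  by move=> mB; apply: le_trans (hmu1 i B mB) (hmu ord0 B mB).
have n_mu i B : measurable B -> (n i B <= mu B)%E.
  by move=> mB; apply: le_trans (hmu2 i B mB) (hmu (lift ord0 ord0) B mB).
have /choice[rho hrho] := fun i => real_density (m_mu i).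
pose G i k : T -> R := fun x => polar_dir (P i) x ord0 k * rho i x.
have mdir i k : measurable_fun setT (fun x : T => polar_dir (P i) x ord0 k).
  exact: polar_dir_measurable.
have mG i k : measurable_fun setT (G i k).
  by apply: measurable_funM => //; have [] := hrho i.
have dir_le1 i : {ae m i, forall x, forall k, `|polar_dir (P i) x ord0 k| <= 1}.
  have [N [mN N0 hN]] := polar_dir_le1 (P i).
  exists N; split => //; apply/eqP; rewrite -measure_le0 -N0.
  apply: (@le_measure _ _ _ (polar_tv (P i)) (N `&` K) N); rewrite ?inE//.
  exact: measurableI.
have G_le i k B : measurable B -> (\int[mu]_(x in B) `|G i k x|%:E <= mu B)%E.
  move=> mB; have [_ _ _ habs _] := hrho i.
  rewrite /G habs//; apply: le_trans (m_mu i B mB).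
  rewrite -[leRHS]mul1e -(integral_cst (m i) mB).
  apply: ae_ge0_le_integral => //.
    by apply/measurable_EFinP; apply: measurable_funTS; exact: measurableT_comp.
  apply: (@filterS _ _ (ae_filter_ringOfSetsType (m i))) (dir_le1 i) => x hx _.
  by rewrite lee_fin hx.
have G_div i (psi : V -> R) (c : R) (x : V) (r : R) : test_function W psi ->
    (forall y, `|psi y| <= c) -> (forall y, ~ ball x r y -> psi y = 0) ->
    `|\sum_(k < d) \int[mu]_y (partial k psi y * G i k y)| <= c * fine (mu (ball x r)).
  move=> tpsi psic psi0; have [spsi cpsi psiW] := tpsi.
  have tO : test_function Omega psi.
    by split => //; apply: subset_trans psiW _; exact: subset_trans KO.
  have mdpsi k : measurable_fun setT (partial k psi : T -> R).
    by apply: borel_continuous; have [] := spsi [:: k].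
  have idir k : (m i).-integrable setT
      (EFin \o (fun y => partial k psi y * polar_dir (P i) y ord0 k)).
    have [M hM] := partial_bounded k tpsi.
    have M0 : 0 <= M by exact: le_trans (hM 0).
    have mpd : measurable_fun setT (fun y : T => partial k psi y * polar_dir (P i) y ord0 k).
      exact: measurable_funM.
    apply/integrableP; split; first exact/measurable_EFinP.
    apply: (@le_lt_trans _ _ (\int[m i]_y (M%:E))%E).
      apply: ae_ge0_le_integral => //.
        by apply/measurable_EFinP; exact: measurableT_comp.
      apply: (@filterS _ _ (ae_filter_ringOfSetsType (m i))) (dir_le1 i) => y hy _.
      by rewrite /= lee_fin normrM -[leRHS]mulr1 ler_pM.
    by rewrite integral_cst// lte_mul_pinfty// ltey_eq fin_num_measure.
  have -> : \sum_(k < d) \int[mu]_y (partial k psi y * G i k y) = boundary (P i) psi.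
    transitivity (\sum_(k < d) \int[m i]_y (partial k psi y * polar_dir (P i) y ord0 k)).
      apply: eq_bigr => k _; have [_ _ _ _ <-] := hrho i => //.
      by apply: eq_Rintegral => y _; rewrite /G mulrA.
    rewrite -Rintegral_sum// /boundary /pairing.
    have out y : ~ K y -> \sum_(k < d) partial k psi y * polar_dir (P i) y ord0 k = 0.
      move=> nK; rewrite big1// => k _; rewrite partial_out ?mul0r// => /psiW/WK.
      exact: nK.
    rewrite (@Rintegral_supp _ T R (m i) _ K mK)//.
    rewrite [RHS](@Rintegral_supp _ T R _ _ K mK); last first.
      by move=> y nK; rewrite -[RHS](out y nK); apply: eq_bigr => k _; rewrite mxE.
    rewrite /Rintegral (@eq_measure_integral _ _ _ (K : set T) (polar_tv (P i))); last first.
      move=> B mB BK; have BE : polar_tv (P i) (B `&` K) = polar_tv (P i) B.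
        by rewrite setIidl.
      exact: BE.
    congr fine; apply: eq_integral => y _; congr EFin.
    by apply: eq_bigr => k _; rewrite mxE.
  have mB : measurable (ball x r : set T) by exact: borel_ball.
  have c0 : 0 <= c by exact: le_trans (psic 0).
  have [_ hb] := hq i.
  apply: (le_trans (hb psi c (ball x r `&` K) tO _ _ psic _)).
  - exact: measurableI.
  - apply: le_lt_trans (qfin i); apply: le_measure; rewrite ?inE//.
    exact: measurableI.
  - move=> y nBK; have [By|/psi0//] := pselect (ball x r y).
    apply/eqP/negPn/negP => py; apply: nBK; split => //; apply: WK; apply: psiW.
    exact: subset_closure.
  - rewrite ler_wpM2l// -nE; apply: fine_le; rewrite ?fin_num_measure//.
    exact: n_mu.
have d0 : (0 < d)%N.
  by rewrite -(@ltr_nat R); exact: le_lt_trans kd.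
pose i0 := Ordinal d0.
(* sigma << ||T_0|| <= mu on K *)
have transfer (N : set T) : mu.-negligible N -> sigma.-negligible (N `&` K).
  move=> [N' [mN' N'0 NN']]; exists (N' `&` K); split.
  - exact: measurableI.
  - have /null_content_dominatesP := @sigma_tv i0; apply; first exact: measurableI.
    apply/eqP; rewrite -measure_le0 -N'0; exact: (m_mu i0).
  - by move=> x [Nx Kx]; split => //; exact: NN'.
have rho_null i : sigma.-negligible ([set x | rho i x = 0] `&` K).
  have [mrho rho0 hint _ _] := hrho i.
  have mZ : measurable [set x | rho i x = 0].
    by rewrite -[X in measurable X]setTI; exact: (mrho measurableT [set 0]).
  exists ([set x | rho i x = 0] `&` K); split => //; first exact: measurableI.
  have /null_content_dominatesP := @sigma_tv i; apply; first exact: measurableI.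
  transitivity (m i [set x | rho i x = 0]); first by [].
  by rewrite hint//; apply: integral0_eq => x /= ->.
pose good : set V := [set x | [/\ A x, W x, lebesgue_at mu G x &
  (\matrix_(i, k) G i k x) \in unitmx]].
have good_null : mu.-negligible (good : set T).
  apply: (@decay_negligible _ _ mu A good kappa k0 hA); first by move=> x [].
  move=> x [_ Wx lx Gx].
  have [r1 /= r10 hr1] : exists2 r1 : R, 0 < r1 & ball x r1 `<=` W.
    have /nbhs_ballP[r1 /= r10 h] : nbhs x W by exact: open_nbhs_nbhs.
    by exists r1.
  pose N := invmx (\matrix_(i, k) G i k x).
  have NG j k : \sum_(i < d) N j i * G i k x = (j == k)%:R.
    have /matrixP/(_ j k) := mulVmx Gx; rewrite !mxE => <-.
    by apply: eq_bigr => i _; rewrite !mxE.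
  have [C [delta [C0 delta0 hstep]]] := decay_step mG G_le G_div NG r10 hr1 lx.
  apply: (@power_decay R (fun r => fine (mu (ball x r))) d kappa C delta) => //.
  - by move=> r; exact: fine_ge0.
  - by move=> r s; exact: fine_measure_ball_le.
  - by rewrite k0.
have bad_null := transfer _ (ae_lebesgue_at mG G_le).
have rho_all : sigma.-negligible (\bigcup_k
    (if insub k is Some i then [set x | rho i x = 0] `&` K else set0)).
  apply: negligible_bigcup => k; case: insubP => [i _ _|_]; first exact: rho_null.
  exact: negligible_set0.
apply: negligibleS (negligibleU (negligibleU (transfer _ good_null) bad_null)
  (negligibleU span_dir rho_all)) => x [Ax Wx].
have Kx := WK x Wx.
have [lx|nlx] := pselect (lebesgue_at mu G x); last by left; right.
have [sx|nsx] := pselect (<<[seq polar_dir (P i) x | i <- enum 'I_d]>>%VS = fullv);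
  last by right; left.
have [[i rhoi]|rho_neq0] := pselect (exists i, rho i x = 0).
  by right; right; exists i => //; rewrite valK.
left; left; split => //; split => //.
have -> : \matrix_(i, k) G i k x =
    diag_mx (\row_i rho i x) *m \matrix_(i, k) polar_dir (P i) x ord0 k.
  apply/matrixP => i k; rewrite !mxE (bigD1 i)//= !mxE eqxx mulr1n mulrC.
  by rewrite big1 ?addr0// => j; rewrite eq_sym => /negbTE ji; rewrite !mxE ji mulr0n mul0r.
rewrite unitmx_mul span_unitmx// andbT unitmxE det_diag unitfE.
apply/prodf_neq0 => i _; rewrite mxE; apply/eqP => h; apply: rho_neq0.
by exists i.
Qed.

End Local.

Theorem corollary8 (R : realType) (d : nat) (Omega : set 'rV[R]_d)
    (T : 'I_d -> radon_measure Omega d)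
    (P : forall i, polar_decomposition (T i))
    (sigma : {measure set (borel R d) -> \bar R}) :
  open Omega ->
  (forall i, normal_current (P i)) ->
  positive_radon Omega sigma ->
  (forall i, sigma `<< polar_tv (P i)) ->
  {ae sigma, forall x : borel R d,
     <<[seq polar_dir (P i) x | i <- enum 'I_d]>>%VS = fullv} ->
  forall kappa : R, 0 <= kappa < d%:R -> sigma `<< hausdorff kappa.
Proof.
move=> oO nP [sO _] sP span kappa hk B hB A mA AB.
have hA : hausdorff kappa A = 0%E by exact: hB.
(* Omega is exhausted by the countably many closed cubes with rational data in it *)
pose cb (p : 'rV[rat]_d * rat) : 'rV[R]_d * R := (map_mx ratr p.1, ratr p.2).
pose K (p : 'rV[rat]_d * rat) : set 'rV[R]_d := [set y | `|(cb p).1 - y| <= (cb p).2].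
pose W (p : 'rV[rat]_d * rat) : set 'rV[R]_d := ball (cb p).1 (cb p).2.
have null p : K p `<=` Omega -> sigma.-negligible (A `&` W p : set (borel R d)).
  move=> KO; apply: (local_null nP sP span (K := K p)) hA => //.
  - exact: closed_cube_compact.
  - exact: ball_open.
  - by move=> y; rewrite /W -ball_normE /ball_/= => /ltW.
suff : sigma.-negligible (A : set (borel R d)).
  by move=> /negligible_null_set; apply.
have cover : sigma.-negligible (\bigcup_k
    (if unpickle k is Some p then if `[< K p `<=` Omega >] then A `&` W p else set0
     else set0 : set (borel R d))).
  apply: negligible_bigcup => k; case: unpickle => [p|]; last exact: negligible_set0.
  by case: asboolP => [/null//|_]; exact: negligible_set0.
have mO : measurable (~` Omega : set (borel R d)).
  by apply: measurableC; exact: borel_open.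
have out : sigma.-negligible (~` Omega : set (borel R d)) .
  by exists (~` Omega); split.
apply: negligibleS (negligibleU cover out) => x Ax.
have [Ox|nOx] := pselect (Omega x); last by right.
left; have /nbhs_ballP[r /= r0 hr] : nbhs (x : 'rV[R]_d) Omega.
  exact: open_nbhs_nbhs.
have r40 : 0 < r / 8 by rewrite divr_gt0.
have [c [q [/andP[q2 q3] xc]]] := rational_ball x r40.
exists (pickle (c, q)) => //; rewrite pickleK; case: asboolP => [_|]; last first.
  case=> y; rewrite /K/= => cy; apply: hr.
  rewrite -ball_normE /ball_/=; move: xc; rewrite -ball_normE /ball_/= => xc.
  apply: (le_lt_trans (ler_distD (map_mx ratr c) _ _)); lra.
split => //; rewrite /W/=; apply: le_ball (ball_sym xc); lra.
Qed.
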